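(* Let $X$ be a $q$-homogeneous tree with $q\ge 2$, let $a,b\in\mathbb{R}$, and let $\alpha>1$ and $c>1$. The following conditions are equivalent: (i) the operator $S_{a,b,c}$ is bounded on $L^1_\alpha$; (ii) the operator $T_{a,b,c}$ is bounded on $L^1_\alpha$; (iii) the parameters either satisfy $$c=a+b,\qquad -a<\alpha-1<b-1,$$ or satisfy $$c<a+b,\qquad -a<\alpha-1\le b-1.$$
   Context: A $q$-homogeneous tree $X$ ($q\ge 2$ an integer) is an undirected connected cycle-free graph in which every vertex has exactly $q+1$ neighbours; $X$ also denotes its vertex set, $o\in X$ is a fixed origin and $|x|$ is the graph distance of $x$ from $o$. A function $f:X\to\mathbb{C}$ is harmonic if $f(v)=\frac1{q+1}\sum_{u\sim v}f(u)$ for every $v\in X$, where $u\sim v$ means adjacency. For $\alpha>1$, $\mu_\alpha$ is the finite measure on $X$ with density $\mu_\alpha(x)=q^{-\alpha|x|}$ with respect to the counting measure. $L^p_\alpha$ is the space of $f:X\to\mathbb{C}$ with $\|f\|_{L^p_\alpha}^p=\sum_{x\in X}|f(x)|^pq^{-\alpha|x|}<\infty$. For $c>1$, $\mathcal{A}^2_c$ is the Hilbert space of harmonic functions in $L^2_c$ (scalar product $\sum_x f(x)\overline{g(x)}q^{-c|x|}$), which is a reproducing kernel Hilbert space, and $K_c:X\times X\to\mathbb{R}$ denotes its reproducing kernel: $K_c(z,\cdot)\in\mathcal{A}^2_c$ and $\sum_x g(x)K_c(z,x)q^{-c|x|}=g(z)$ for all $g\in\mathcal{A}^2_c$, $z\in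 X$. For $a,b\in\mathbb{R}$ and $c>1$ the integral operators $S_{a,b,c}$ and $T_{a,b,c}$ are $$S_{a,b,c}f(z)=q^{-a|z|}\sum_{x\in X}|K_c(z,x)|f(x)q^{-b|x|},\qquad T_{a,b,c}f(z)=q^{-a|z|}\sum_{x\in X}K_c(z,x)f(x)q^{-b|x|}.$$ *)

(* Defs.v *)
From mathcomp Require Import all_boot all_order all_algebra.
From mathcomp Require Import all_classical all_reals all_analysis.
From mathcomp Require Export complex.

Set Implicit Arguments.
Unset Strict Implicit.
Unset Printing Implicit Defensive.

Import Order.TTheory GRing.Theory Num.Theory.

Local Open Scope classical_set_scope.
Local Open Scope ring_scope.

Section Tree.
Variables (X : choiceType) (adj : rel X).

(* The bound on [size c] is not a restriction on girth: a pair of adjacent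
   vertices x, y gives the degenerate cycle [:: x; y] in the sense of path.v,
   so excluding simple cycles of length >= 3 is excluding all graph cycles. *)
Definition acyclic_graph : Prop :=
  forall c : seq X, ucycle adj c -> (size c <= 2)%N.

Definition connected_graph : Prop :=
  forall x y : X, exists2 p : seq X, path adj x p & last x p = y.

Definition homogeneous_tree (q : nat) : Prop :=
  [/\ symmetric adj, irreflexive adj, connected_graph, acyclic_graph
    & forall v : X, ([set u | adj v u] #= `I_q.+1)%card].

Definition walk_of_length (x y : X) : pred nat :=
  fun n => `[< exists p : seq X, [/\ path adj x p, last x p = y & size p = n] >].

(* Least length of a walk from x to y; 0 if there is none, which does not
   happen in a connected graph. *)
Definition graph_dist (x y : X) : nat :=
  if pselect (exists n, walk_of_length x y n) is left ex_n
  then ex_minn ex_n else 0%N.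

End Tree.

Section Sums.
Variables (R : realType) (X : choiceType).

Definition abs_summable (f : X -> R[i]) : Prop :=
  (\esum_(x in [set: X]) (ComplexField.Normc.normc (f x))%:E < +oo)%E.

Definition real_sum (f : X -> R) : R :=
  fine (\esum_(x in [set: X]) (Num.max (f x) 0)%:E)
  - fine (\esum_(x in [set: X]) (Num.max (- f x) 0)%:E).

(* The unordered sum of f; meaningful when [abs_summable f]. *)
Definition complex_sum (f : X -> R[i]) : R[i] :=
  Complex (real_sum (fun x => complex.Re (f x)))
          (real_sum (fun x => complex.Im (f x))).

End Sums.

Section Spaces.
Variables (R : realType) (X : choiceType) (adj : rel X) (o : X) (q : nat).

Definition qweight (s : R) (x : X) : R :=
  q%:R `^ (- (s * (graph_dist adj o x)%:R)).

Definition tree_harmonic (f : X -> R[i]) : Prop :=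
  forall v : X, f v = (q.+1)%:R^-1 * \sum_(u \in [set u | adj v u]) f u.

(* The p-th power of the norm of L^p_alpha. *)
Definition Lp_normpow (p alpha : R) (f : X -> R[i]) : \bar R :=
  \esum_(x in [set: X])
    ((ComplexField.Normc.normc (f x)) `^ p * qweight alpha x)%:E.

Definition in_Lp (p alpha : R) (f : X -> R[i]) : Prop :=
  (Lp_normpow p alpha f < +oo)%E.

Definition Lp_norm (p alpha : R) (f : X -> R[i]) : R :=
  (fine (Lp_normpow p alpha f)) `^ p^-1.

Definition in_Bergman2 (c : R) (f : X -> R[i]) : Prop :=
  tree_harmonic f /\ in_Lp 2 c f.

Definition is_reproducing_kernel (c : R) (K : X -> X -> R) : Prop :=
  forall z : X,
    in_Bergman2 c (fun x => (K z x)%:C%C) /\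
    forall g : X -> R[i], in_Bergman2 c g ->
      complex_sum (fun x => g x * (K z x)%:C%C * (qweight c x)%:C%C) = g z.

(* On a homogeneous tree with q >= 2 and for c > 1 there is exactly one K with
   [is_reproducing_kernel c K]; the default value 0 is then irrelevant. *)
Definition bergman_kernel (c : R) : X -> X -> R :=
  xget (fun _ _ : X => 0) [set K | is_reproducing_kernel c K].

Definition op_term (N : X -> X -> R) (b : R) (f : X -> R[i]) (z x : X) : R[i] :=
  (N z x)%:C%C * f x * (qweight b x)%:C%C.

Definition integral_op (N : X -> X -> R) (a b : R) (f : X -> R[i]) : X -> R[i] :=
  fun z => (qweight a z)%:C%C * complex_sum (op_term N b f z).

(* Boundedness on L^p_alpha includes that the series defining the operator
   converges absolutely at every z, for every f in L^p_alpha. *)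
Definition integral_op_bounded (N : X -> X -> R) (a b p alpha : R) : Prop :=
  exists C : R, forall f : X -> R[i], in_Lp p alpha f ->
    [/\ forall z : X, abs_summable (op_term N b f z),
        in_Lp p alpha (integral_op N a b f)
      & Lp_norm p alpha (integral_op N a b f) <= C * Lp_norm p alpha f].

Definition S_bounded (a b c p alpha : R) : Prop :=
  integral_op_bounded (fun z x => `|bergman_kernel c z x|) a b p alpha.

Definition T_bounded (a b c p alpha : R) : Prop :=
  integral_op_bounded (bergman_kernel c) a b p alpha.

End Spaces.

(* Main.v *)
Require Import Defs.
From mathcomp Require Import all_boot all_order all_algebra.
From mathcomp Require Import all_classical all_reals all_analysis.
From mathcomp Require Import ring lra zify.

(**
Write s = alpha + a and |x| for the distance to o. An integral operator on a
weighted l^1 space is bounded exactly when the weighted l^1 norms of its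
columns are, and this test sees the kernel only through its absolute value:
that is why S and T are bounded together, and it reduces everything to

  sup_x q^((alpha-b)|x|) sum_z |K_c(z,x)| q^(-s|z|) < oo

([integral_op_bounded_column], [column_bound_integral_op]).

The kernel is known explicitly. Root the tree at o; the sector of v is v with
its descendants. For harmonic g the increments D g(v) = g(v) - g(parent v)
form a finitely additive measure on the boundary: D g(v) is the sum of D g over
the children of v. Hence the sums of g over the levels of a sector depend only
on g(v) and D g(v) ([sum_sector]). For u a child of v, let phi_u be the harmonic
function that vanishes off the sector of v, takes at distance n below v the
value kappa(n) (1 - 1/N) in the sector of u and - kappa(n) / N in the sectors of
its siblings, N being the number of children of v and
kappa(n) = 1 + 1/q + ... + q^(-(n-1)). Pairing with phi_u extracts
D g(u) - D g(v) / q ([sum_sphere_basis_fun]), and g is recovered from these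
numbers along the geodesic from o to z by a telescoping sum ([kappa_telescope],
[sum_increment_ancestor]). This gives

  K_c(z,x) = 1/mass + 1/gram sum_(l < |z|) q^(c l) kappa(|z|-l) phi_(z_(l+1))(x)

where z_l is the ancestor of z at level l ([cvg_sector_kernel]). Reproducing
kernels are unique, so this is the Bergman kernel ([bergman_kernelE]).

Consequently |K_c(z,x)| is at most a constant times the sum of q^(c l) over the
levels l at which z and x have a common ancestor ([sector_kernel_le]), while
K_c(z,x) is at least a constant times q^(c m) when z is the ancestor of x at
level m ([sector_kernel_ge]). If s > 1, the weighted size of the sector of x_l
is of order q^(-s l), so the column of x is comparable to
sum_(l <= |x|) q^((c-s) l); if s <= 1, the column of o, on which K_c is
constant, already diverges. With r = q^(alpha-b) and p = q^(c-a-b) the condition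
therefore reads: s > 1 and the sums sum_(l <= n) r^(n-l) p^l are bounded in n
([column_boundP]), that is r <= 1, p <= 1 and not both equal to 1
([mixed_geometric_bounded]). Taking logarithms gives the two stated ranges.
*)

Set Implicit Arguments.
Unset Strict Implicit.
Unset Printing Implicit Defensive.

Import Order.TTheory GRing.Theory Num.Theory.
Import numFieldNormedType.Exports.
Import ComplexField.Normc.

Local Open Scope classical_set_scope.
Local Open Scope ring_scope.

(** * Homogeneous trees as rooted trees *)

(** The combinatorial data that the analysis uses: parents, children and
    levels. The root is its own parent, so that the increment g x - g (par x)
    of a function vanishes at the root and the root needs no separate case. *)
Record rooted_tree (X : choiceType) (o : X) (q : nat)
    (par : X -> X) (ch : X -> seq X) (lvl : X -> nat) : Prop := RootedTree {
  lvl_eq0 : forall x, (lvl x == 0%N) = (x == o);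
  par_root : par o = o;
  lvl_par : forall x, lvl (par x) = (lvl x).-1;
  mem_ch : forall x y, (y \in ch x) = (y != o) && (par y == x);
  uniq_ch : forall x, uniq (ch x);
  size_ch : forall x, size (ch x) = if x == o then q.+1 else q }.

Section Distance.
Variables (X : choiceType) (adj : rel X).
Hypothesis conn : connected_graph adj.

Lemma graph_dist_path x y :
  exists p, [/\ path adj x p, last x p = y & size p = graph_dist adj x y].
Proof.
rewrite /graph_dist; case: pselect => [ex_n|[]].
  by case: ex_minnP => m /asboolP.
by have [p xp py] := conn x y; exists (size p); apply/asboolP; exists p.
Qed.

Lemma graph_dist_min x p : path adj x p ->
  (graph_dist adj x (last x p) <= size p)%N.
Proof.
move=> xp; rewrite /graph_dist; case: pselect => [ex_n|//].
by case: ex_minnP => m _; apply; apply/asboolP; exists p.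
Qed.

Lemma graph_distxx x : graph_dist adj x x = 0%N.
Proof. by have /(_ isT) := @graph_dist_min x [::];
  rewrite /= leqn0 => /eqP. Qed.

Lemma graph_dist_eq0 x y : (graph_dist adj x y == 0%N) = (y == x).
Proof.
apply/idP/eqP => [/eqP d0|->]; last by rewrite graph_distxx.
by have [p [_ py]] := graph_dist_path x y; rewrite d0 -py => /size0nil ->.
Qed.

Lemma graph_dist_adj o x y : adj x y ->
  (graph_dist adj o y <= (graph_dist adj o x).+1)%N.
Proof.
move=> xy; have [p [op px <-]] := graph_dist_path o x.
have := @graph_dist_min o (rcons p y).
by rewrite rcons_path op px xy last_rcons size_rcons; apply.
Qed.

Lemma graph_dist_pred o x n : graph_dist adj o x = n.+1 ->
  exists2 y, adj y x & graph_dist adj o y = n.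
Proof.
move=> xn; have [p [op px sp]] := graph_dist_path o x.
move: sp op px; rewrite xn; case/lastP: p => // p y.
rewrite size_rcons last_rcons rcons_path => -[sp] /andP[op py] yx; subst y.
exists (last o p) => //; apply/eqP; rewrite eqn_leq -{1}sp graph_dist_min//=.
by rewrite -ltnS -xn graph_dist_adj.
Qed.

Hypothesis sym : symmetric adj.

(** Starting from x, each step goes to a neighbour one level lower; such a path
    can only meet vertices strictly closer to o than x. *)
Lemma descending_path o x : exists p, [/\ path adj x p, last x p = o &
  all (fun z => (graph_dist adj o z < graph_dist adj o x)%N) p].
Proof.
have [n] := ubnP (graph_dist adj o x); elim: n x => // n IH x.
case E: (graph_dist adj o x) => [|m] mn.
  by exists [::]; split=> //; apply/eqP; rewrite -graph_dist_eq0 E.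
have [y yx ym] := graph_dist_pred E.
have [|p [yp po pa]] := IH y; first by rewrite ym.
exists (y :: p); split => //=; first by rewrite sym yx.
rewrite ym ltnSn /=; apply: sub_all pa => z; rewrite ym => /ltn_trans; exact.
Qed.

Hypotheses (irr : irreflexive adj) (acy : acyclic_graph adj).

(** Two distinct neighbours of v that are not further from o than v would
    descend to o along paths that avoid v; joining these paths and removing the
    loops would close a simple cycle through v. *)
Lemma unique_lower_neighbor o v u1 u2 : adj v u1 -> adj v u2 ->
  (graph_dist adj o u1 <= graph_dist adj o v)%N ->
  (graph_dist adj o u2 <= graph_dist adj o v)%N -> u1 = u2.
Proof.
move=> vu1 vu2 l1 l2; apply/eqP; apply/negPn/negP => u12.
have avoid u p : adj v u -> (graph_dist adj o u <= graph_dist adj o v)%N ->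
    all (fun z => (graph_dist adj o z < graph_dist adj o u)%N) p ->
    v \notin u :: p.
  move=> vu lu /allP pa; rewrite inE negb_or; apply/andP; split.
    by apply/negP => /eqP vE; rewrite -vE irr in vu.
  by apply/negP => /pa; rewrite ltnNge lu.
have [p1 [up1 p1o /(avoid _ _ vu1 l1) vp1]] := descending_path o u1.
have [p2 [up2 p2o /(avoid _ _ vu2 l2) vp2]] := descending_path o u2.
(* p goes from u1 to o and back up to u2, and does not visit v *)
pose p := p1 ++ rev (belast u2 p2).
have pP : path adj u1 p.
  rewrite cat_path up1 p1o -p2o rev_path.
  by rewrite (eq_path (e' := adj)) // => x y /=; rewrite sym.
have lp : last u1 p = u2.
  by rewrite last_cat p1o; case: (p2) p2o => // y s _;
    rewrite rev_cons last_rcons.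
have vp : v \notin p.
  rewrite mem_cat negb_or (contra _ vp1); last by rewrite inE orbC => ->.
  by apply: contra vp2; rewrite mem_rev => /mem_belast.
move: lp; case/shortenP: pP => p' p'P uni sub lp.
have := acy (c := v :: u1 :: p'); rewrite /ucycle.
have -> : cycle adj (v :: u1 :: p').
  by rewrite /cycle rcons_path /= vu1 p'P lp sym.
have -> : uniq [:: v, u1 & p'].
  rewrite cons_uniq uni andbT inE negb_or.
  apply/andP; split; first by move: vp1; rewrite inE negb_or => /andP[].
  by apply/negP => /sub; apply/negP.
move=> /(_ isT); case: p' lp {p'P uni sub} => [/= E|//].
by rewrite E eqxx in u12.
Qed.

End Distance.

Section TreeStructure.
Variables (X : choiceType) (adj : rel X) (o : X) (q : nat).

Definition neighbors (x : X) : seq X :=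
  finmap.enum_fset (fset_set [set u | adj x u]).

(** At o there is no closer neighbour, and the default value makes o its own
    parent. *)
Definition parent (x : X) : X :=
  xget o [set u | adj x u /\ (graph_dist adj o u < graph_dist adj o x)%N].

Definition children (x : X) : seq X :=
  [seq y <- neighbors x | (graph_dist adj o x < graph_dist adj o y)%N].

Hypothesis tree : homogeneous_tree adj q.

Let lvl := graph_dist adj o.
Let sym : symmetric adj. Proof. by case: tree. Qed.
Let irr : irreflexive adj. Proof. by case: tree. Qed.
Let conn : connected_graph adj. Proof. by case: tree. Qed.
Let acy : acyclic_graph adj. Proof. by case: tree. Qed.

Lemma finite_neighbors v : finite_set [set u | adj v u].
Proof. by case: tree => _ _ _ _ /(_ v) vq; exists q.+1. Qed.

Lemma mem_neighbors v u : (u \in neighbors v) = adj v u.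
Proof.
rewrite /neighbors in_fset_set; last exact: finite_neighbors.
by apply/idP/idP; rewrite inE.
Qed.

Lemma parentP x : x != o -> adj x (parent x) /\ (lvl (parent x) < lvl x)%N.
Proof.
move=> xo; rewrite /parent; case: xgetP => [y _ []//|/= no].
have : lvl x != 0%N by rewrite graph_dist_eq0.
case E: (lvl x) => [//|n] _; have [y yx yn] := graph_dist_pred conn E.
by case: (no y); rewrite sym yn; move: E; rewrite /lvl => ->.
Qed.

Lemma parent_uniq x u : adj x u -> (lvl u <= lvl x)%N -> u = parent x.
Proof.
move=> xu ux.
have xo : x != o.
  apply/negP => /eqP xo; move: ux; rewrite xo /lvl graph_distxx// leqn0.
  by rewrite graph_dist_eq0// => /eqP uo; rewrite xo uo irr in xu.
have [xp px] := parentP xo.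
exact: (unique_lower_neighbor (o := o) conn sym irr acy xu xp ux (ltnW px)).
Qed.

Lemma mem_children x y : (y \in children x) = (y != o) && (parent y == x).
Proof.
rewrite mem_filter mem_neighbors; apply/andP/andP => [[xy xay]|[yo /eqP <-]].
  split; last by rewrite eq_sym; apply/eqP/parent_uniq; rewrite 1?sym// ltnW.
  by rewrite -(graph_dist_eq0 conn) -lt0n (leq_ltn_trans _ xy).
by have [] := parentP yo; rewrite sym.
Qed.

(** A neighbour that is not further from o than x is the parent of x, by
    uniqueness of lower neighbours. *)
Lemma perm_neighbors x :
  perm_eq (neighbors x) (if x == o then children x else parent x :: children x).
Proof.
have uch : uniq (children x) by rewrite filter_uniq// finmap.fset_uniq.
have pch : parent x \notin children x.
  rewrite mem_filter negb_and -leqNgt.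
  case: (eqVneq x o) => [->|xo]; last by have [_ /ltnW ->] := parentP xo.
  rewrite /parent; case: xgetP => [y _ []//|/= no]; last by rewrite leqnn.
  by rewrite [X in (_ < X)%N]graph_distxx.
apply: uniq_perm; first exact: finmap.fset_uniq.
  by case: eqP => // _; rewrite cons_uniq pch.
move=> u; rewrite mem_neighbors; have [xo|xo] := eqVneq x o; last first.
  rewrite inE [in RHS]mem_filter mem_neighbors.
  apply/idP/orP => [xu|[/eqP ->|/andP[]//]]; last by case: (parentP xo).
  case: (ltnP (lvl x) (lvl u)) => ux; first by right; rewrite xu andbT.
  by left; apply/eqP/parent_uniq.
rewrite mem_filter mem_neighbors xo; case ou: (adj o u); rewrite ?andbF// andbT.
rewrite graph_distxx// lt0n graph_dist_eq0//; symmetry.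
by apply/negP => /eqP uo; rewrite uo irr in ou.
Qed.

Lemma tree_rooted : rooted_tree o q parent children lvl.
Proof.
split.
- by move=> x; rewrite graph_dist_eq0.
- rewrite /parent; case: xgetP => [y _ []|//].
  by rewrite (graph_distxx adj o)//.
- move=> x; case: (eqVneq x o) => [->|xo].
    have -> : parent o = o.
      by rewrite /parent; case: xgetP => [y _ []|//];
        rewrite (graph_distxx adj o).
    by rewrite /lvl graph_distxx.
  have [xp px] := parentP xo; apply/eqP; rewrite eqn_leq.
  have := graph_dist_adj conn o (x := parent x) (y := x);
    rewrite sym => /(_ xp).
  rewrite -/lvl; move: px; case: (lvl x) => //= n.
  by rewrite !ltnS => -> ->.
- exact: mem_children.
- by move=> x; rewrite filter_uniq// finmap.fset_uniq.
- move=> x; have := perm_size (perm_neighbors x).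
  have -> : size (neighbors x) = q.+1.
    by apply: card_fset_set; case: tree.
  by case: eqP => // _ /= [].
Qed.

Lemma sum_neighbors (V : nmodType) (f : X -> V) x :
  \sum_(u \in [set u | adj x u]) f u =
  \sum_(u <- children x) f u + (if x == o then 0 else f (parent x)).
Proof.
rewrite fsbig_finite; last exact: finite_neighbors.
rewrite (perm_big _ (perm_neighbors x)); case: eqP => [_|_].
  by rewrite addr0.
by rewrite big_cons addrC.
Qed.

End TreeStructure.

(** * Spheres and balls around the root *)

Section Layers.
Variables (X : choiceType) (o : X) (q : nat) (par : X -> X) (ch : X -> seq X)
  (lvl : X -> nat).
Hypothesis T : rooted_tree o q par ch lvl.

Fixpoint sphere (ch : X -> seq X) (o : X) n : seq X :=
  if n is m.+1 then flatten (map ch (sphere ch o m)) else [:: o].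

Definition tree_ball (ch : X -> seq X) (o : X) n : seq X :=
  flatten (map (sphere ch o) (iota 0 n)).

Lemma lvl_ch x y : y \in ch x -> lvl y = (lvl x).+1.
Proof.
rewrite (mem_ch T) => /andP[yo /eqP <-]; rewrite (lvl_par T) prednK// lt0n.
by rewrite (lvl_eq0 T).
Qed.

Lemma mem_sphere n x : (x \in sphere ch o n) = (lvl x == n).
Proof.
elim: n x => [|n IH] x /=; first by rewrite inE (lvl_eq0 T).
apply/flatten_mapP/idP => [[y]|/eqP xn].
  by rewrite IH => /eqP <- /lvl_ch ->.
exists (par x); first by rewrite IH (lvl_par T) xn.
by rewrite (mem_ch T) eqxx andbT -(lvl_eq0 T) xn.
Qed.

Lemma uniq_flatten_disjoint (A : eqType) (f : A -> seq X) (s : seq A) :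
  uniq s -> (forall a, uniq (f a)) ->
  (forall a b x, x \in f a -> x \in f b -> a = b) -> uniq (flatten (map f s)).
Proof.
move=> us uf disj; elim: s us => //= a s IH /andP[aNs us].
rewrite cat_uniq uf IH// andbT /=; apply/hasPn => x /flatten_mapP[b bs xb].
by apply/negP => xa; move: aNs; rewrite (disj _ _ _ xa xb) bs.
Qed.

Lemma uniq_sphere n : uniq (sphere ch o n).
Proof.
elim: n => //= n IH; apply: uniq_flatten_disjoint => // [x|x y z].
  exact: uniq_ch T x.
by rewrite !(mem_ch T) => /andP[_ /eqP <-] /andP[_ /eqP <-].
Qed.

Lemma mem_tree_ball n x : (x \in tree_ball ch o n) = (lvl x < n)%N.
Proof.
apply/flatten_mapP/idP => [[m]|xn];
  first by rewrite mem_iota mem_sphere => /= ? /eqP ->.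
by exists (lvl x); rewrite ?mem_iota// mem_sphere.
Qed.

Lemma uniq_tree_ball n : uniq (tree_ball ch o n).
Proof.
apply: uniq_flatten_disjoint (iota_uniq _ _) uniq_sphere _ => i j x.
by rewrite !mem_sphere => /eqP -> /eqP.
Qed.

Lemma homo_tree_ball m n : (m <= n)%N ->
  {subset tree_ball ch o m <= tree_ball ch o n}.
Proof. by move=> mn x; rewrite !mem_tree_ball => /leq_trans; apply. Qed.

Lemma cover_tree_ball x : exists n, x \in tree_ball ch o n.
Proof. by exists (lvl x).+1; rewrite mem_tree_ball. Qed.

Section Sums.
Variables (V : nmodType) (F : X -> V).

Lemma sum_sphere0 : \sum_(x <- sphere ch o 0) F x = F o.
Proof. by rewrite big_seq1. Qed.

Lemma sum_sphereS n :
  \sum_(x <- sphere ch o n.+1) F x =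
    \sum_(y <- sphere ch o n) \sum_(x <- ch y) F x.
Proof. by rewrite /= big_flatten big_map. Qed.

Lemma sum_tree_ball n :
  \sum_(x <- tree_ball ch o n) F x = \sum_(k < n) \sum_(x <- sphere ch o k) F x.
Proof.
rewrite /tree_ball big_flatten big_map.
by rewrite -(big_mkord xpredT (fun k => \sum_(x <- sphere ch o k) F x))
  /index_iota subn0.
Qed.

End Sums.

End Layers.

(** * Unordered sums *)

Section Exhaustion.
Variables (R : realType) (X : choiceType) (B : nat -> seq X).
Hypotheses (uniqB : forall n, uniq (B n))
  (homoB : forall m n, (m <= n)%N -> {subset B m <= B n})
  (coverB : forall x, exists n, x \in B n).
Implicit Type F : X -> R.

(** A partial sum along the exhaustion is one of the finite sums whose supremum
    is the unordered sum. *)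
Lemma sum_exhaustion_le F n :
  ((\sum_(x <- B n) F x)%:E <= \esum_(x in [set: X]) (F x)%:E)%E.
Proof.
apply: esum_ge; exists [set` B n]; first by split.
by rewrite -fsbig_seq// sumEFin.
Qed.

(** Conversely, every finite subset is contained in some [B n]. *)
Lemma esum_exhaustion_le F M : (forall x, 0 <= F x) ->
  (forall n, \sum_(x <- B n) F x <= M) ->
  (\esum_(x in [set: X]) (F x)%:E <= M%:E)%E.
Proof.
move=> F0 FM; apply: ge_ereal_sup => _ [A [finA _] <-].
pose s : seq X := finmap.enum_fset (fset_set A).
have us : uniq s by exact: finmap.fset_uniq.
have -> : (\sum_(x \in A) (F x)%:E = (\sum_(x <- s) F x)%:E)%E.
  by rewrite fsbig_finite// sumEFin.
have [n sn] : exists n, {subset s <= B n}.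
  elim: (s) => [|x t [n tn]]; first by exists 0%N.
  have [m xm] := coverB x; exists (maxn m n) => y;
    rewrite inE => /orP[/eqP ->|/tn].
    by apply: homoB xm; rewrite leq_maxl.
  by apply: homoB; rewrite leq_maxr.
rewrite lee_fin; apply: le_trans (FM n).
have -> : \sum_(x <- s) F x = \sum_(x <- B n | x \in s) F x.
  rewrite -[RHS]big_filter; apply: perm_big; apply: uniq_perm => //.
    by rewrite filter_uniq.
  by move=> x; rewrite mem_filter; case xs: (x \in s) => //=; rewrite sn.
by rewrite [leRHS](bigID (mem s))/= lerDl sumr_ge0.
Qed.

Lemma sum_exhaustion_homo F : (forall x, 0 <= F x) ->
  nondecreasing_seq (fun n => \sum_(x <- B n) F x).
Proof.
move=> F0 m n mn; rewrite [leRHS](bigID (mem (B m)))/=.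
have -> : \sum_(x <- B m) F x = \sum_(x <- B n | x \in B m) F x.
  rewrite -[RHS]big_filter; apply: perm_big; apply: uniq_perm => //.
    by rewrite filter_uniq.
  move=> x; rewrite mem_filter; case xs: (x \in B m) => //=.
  by rewrite (homoB mn).
by rewrite lerDl sumr_ge0.
Qed.

Lemma cvg_sum_exhaustion_ge0 F : (forall x, 0 <= F x) ->
  (\esum_(x in [set: X]) (F x)%:E < +oo)%E ->
  (fun n => \sum_(x <- B n) F x) @ \oo -->
    fine (\esum_(x in [set: X]) (F x)%:E).
Proof.
move=> F0 Foo; set S := fine _.
have S0 : (0 <= \esum_(x in [set: X]) (F x)%:E)%E by apply: esum_ge0 => x _;
  rewrite lee_fin.
have SE : (\esum_(x in [set: X]) (F x)%:E = S%:E)%E.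
  by rewrite fineK// ge0_fin_numE.
have ub n : \sum_(x <- B n) F x <= S.
  by rewrite -lee_fin -SE sum_exhaustion_le.
have hub : has_ubound (range (fun n => \sum_(x <- B n) F x)).
  by exists S => _ [n _ <-].
have <- : sup (range (fun n => \sum_(x <- B n) F x)) = S.
  apply/eqP; rewrite eq_le; apply/andP; split.
    by apply: ge_sup => [|_ [n _ <-]//]; exists (\sum_(x <- B 0%N) F x), 0%N.
  rewrite -lee_fin -SE; apply: esum_exhaustion_le => // n.
  by apply: ub_le_sup => //; exists n.
exact: nondecreasing_cvgn (sum_exhaustion_homo F0) hub.
Qed.

(** Absolutely convergent unordered sums are limits of finite sums along any
    exhaustion; this turns the reproducing formula into an identity between
    finite sums over balls. *)
Lemma cvg_sum_exhaustion F : (\esum_(x in [set: X]) `|F x|%:E < +oo)%E ->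
  (fun n => \sum_(x <- B n) F x) @ \oo --> real_sum F.
Proof.
move=> Foo.
have -> : (fun n => \sum_(x <- B n) F x) =
    (fun n => \sum_(x <- B n) Num.max (F x) 0) \-
    (fun n => \sum_(x <- B n) Num.max (- F x) 0).
  apply/funext => n /=; rewrite -sumrB; apply: eq_bigr => x _.
  have [Fx|/ltW Fx] := lerP 0 (F x).
    by rewrite max_r ?oppr_le0// subr0.
  by rewrite max_l ?oppr_ge0// sub0r opprK.
apply: cvgB; apply: cvg_sum_exhaustion_ge0 => [x|];
  rewrite ?le_max ?lexx ?orbT//;
  apply: le_lt_trans Foo; apply: le_esum => x _;
    rewrite lee_fin ge_max normr_ge0.
  by rewrite ler_norm.
by rewrite -normrN ler_norm.
Qed.

End Exhaustion.

Section Complexes.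
Variable R : realType.
Implicit Types (x : R[i]) (r : R).

Lemma normc_ge0 x : 0 <= normc x.
Proof. by case: x => a b /=; exact: sqrtr_ge0. Qed.

Lemma normc_real r : normc r%:C%C = `|r|.
Proof. by rewrite /= expr0n addr0 sqrtr_sqr. Qed.

Lemma sqr_normc_ReIm x :
  normc x ^+ 2 = complex.Re x ^+ 2 + complex.Im x ^+ 2.
Proof. by case: x => a b /=; rewrite sqr_sqrtr// addr_ge0 ?sqr_ge0. Qed.

Lemma ler_Re_normc x : `|complex.Re x| <= normc x.
Proof.
rewrite -ler_sqr ?nnegrE ?normc_ge0// real_normK ?num_real//.
by rewrite sqr_normc_ReIm lerDl sqr_ge0.
Qed.

Lemma ler_Im_normc x : `|complex.Im x| <= normc x.
Proof.
rewrite -ler_sqr ?nnegrE ?normc_ge0// real_normK ?num_real//.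
by rewrite sqr_normc_ReIm lerDr sqr_ge0.
Qed.

Lemma normc_le_ReIm x : normc x <= `|complex.Re x| + `|complex.Im x|.
Proof.
rewrite -ler_sqr ?nnegrE ?normc_ge0 ?addr_ge0// sqr_normc_ReIm sqrrD.
rewrite !real_normK ?num_real// -addrA lerD2l lerDr mulrn_wge0// mulr_ge0//.
Qed.

Lemma Re_mulrC x r : complex.Re (x * r%:C%C) = complex.Re x * r.
Proof. by case: x => a b /=; rewrite mulr0 subr0. Qed.

Lemma Im_mulrC x r : complex.Im (x * r%:C%C) = complex.Im x * r.
Proof. by case: x => a b /=; rewrite mulr0 add0r. Qed.

End Complexes.

Section UnorderedSums.
Variables (R : realType) (X : choiceType).
Implicit Types (F : X -> \bar R) (f : X -> R).

Local Open Scope ereal_scope.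

Lemma esum_ge_term F x : (forall y, 0 <= F y) -> F x <= \esum_(y in setT) F y.
Proof.
move=> F0; apply: esum_ge; exists [set x]; first by split.
by rewrite fsbig_set1.
Qed.

Lemma esum_single F x : (forall y, y != x -> F y = 0) -> 0 <= F x ->
  \esum_(y in setT) F y = F x.
Proof.
move=> F0 Fx; rewrite -(esum_set1 Fx) [RHS]esum_mkcond; apply: eq_esum => y _.
case: ifPn; rewrite ?inE; first by move=> /= ->.
by move/negP; rewrite inE => /= yx; apply/F0/eqP.
Qed.

(** The inequality for k, applied to k^-1 and the scaled family, gives the
    reverse inequality. *)
Lemma esumZl (k : R) F : (0 <= k)%R -> (forall x, 0 <= F x) ->
  \esum_(x in setT) (k%:E * F x) = k%:E * \esum_(x in setT) F x.
Proof.
move=> k0 F0.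
have le (l : R) G : (0 <= l)%R -> (forall x, 0 <= G x) ->
    \esum_(x in setT) (l%:E * G x) <= l%:E * \esum_(x in setT) G x.
  move=> l0 G0; apply: ge_ereal_sup => _ [A finA <-].
  rewrite -ge0_mule_fsumr// lee_wpmul2l//.
  by apply: esum_ge; exists A.
move: k0; rewrite le_eqVlt => /predU1P[<-|k0].
  by rewrite mul0e esum1// => x _; rewrite mul0e.
apply/eqP; rewrite eq_le le//=; last exact: ltW.
rewrite -lee_pdivlMl//.
apply: (@le_trans _ _ (\esum_(x in setT) (k^-1%:E * (k%:E * F x)))); last first.
  apply: le; first by rewrite invr_ge0 ltW.
  by move=> x; rewrite mule_ge0// lee_fin ltW.
rewrite le_eqVlt; apply/orP; left; apply/eqP; apply: eq_esum => x _.
by rewrite muleA -EFinM mulVf ?gt_eqF// mul1e.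
Qed.

Lemma esum_exchange (G : X -> X -> \bar R) : (forall x y, 0 <= G x y) ->
  \esum_(x in setT) \esum_(y in setT) G x y =
  \esum_(y in setT) \esum_(x in setT) G x y.
Proof.
move=> G0; rewrite !esum_esum//.
rewrite (@reindex_esum _ _ _ (setT `*`` fun=> setT) (setT `*`` fun=> setT)
  (fun p : X * X => (p.2, p.1)))//.
split=> [[x y]//|[x y] [x' y'] _ _ /= [-> ->]//|[x y] _ /=].
by exists (y, x).
Qed.

Lemma normr_real_sum f : \esum_(x in setT) `|f x|%:E < +oo ->
  `|real_sum f|%:E <= \esum_(x in setT) `|f x|%:E.
Proof.
move=> foo; rewrite /real_sum.
set P := \esum_(x in _) (Num.max (f x) 0)%:E.
set N := \esum_(x in _) (Num.max (- f x) 0)%:E.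
set A := \esum_(x in _) _ in foo *.
have P0 : 0 <= P by apply: esum_ge0 => x _; rewrite lee_fin le_max lexx orbT.
have N0 : 0 <= N by apply: esum_ge0 => x _; rewrite lee_fin le_max lexx orbT.
have PA : P <= A.
  by apply: le_esum => x _; rewrite lee_fin ge_max normr_ge0 ler_norm.
have NA : N <= A.
  by apply: le_esum => x _; rewrite lee_fin ge_max normr_ge0 -normrN ler_norm.
have Pf : P \is a fin_num by rewrite ge0_fin_numE// (le_lt_trans PA).
have Nf : N \is a fin_num by rewrite ge0_fin_numE// (le_lt_trans NA).
have [p PE] : exists p, P = p%:E by exists (fine P); rewrite fineK.
have [n NE] : exists n, N = n%:E by exists (fine N); rewrite fineK.
move: P0 N0 PA NA; rewrite PE NE !lee_fin /= => p0 n0 PA NA.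
have [pn|/ltW pn] := lerP n p.
  by apply: le_trans PA; rewrite lee_fin gerBl.
by apply: le_trans NA; rewrite lee_fin gerBl.
Qed.

Lemma real_sum_single f x : (forall y, y != x -> f y = 0%R) -> real_sum f = f x.
Proof.
move=> f0; rewrite /real_sum !(esum_single (x := x)) /=.
- have [fx|/ltW fx] := lerP 0%R (f x).
    by rewrite max_r ?oppr_le0// subr0.
  by rewrite max_l ?oppr_ge0// sub0r opprK.
- by move=> y /f0 ->; rewrite oppr0 maxxx.
- by rewrite lee_fin le_max lexx orbT.
- by move=> y /f0 ->; rewrite maxxx.
- by rewrite lee_fin le_max lexx orbT.
Qed.

(** The factor 2 comes from bounding the modulus by the real and imaginary
    parts separately, which costs only a constant in the operator norm. *)
Lemma normc_complex_sum (f : X -> R[i]) : abs_summable f ->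
  (normc (complex_sum f))%:E <= 2%:E * \esum_(x in setT) (normc (f x))%:E.
Proof.
rewrite /abs_summable => foo.
apply: (@le_trans _ _ (`|real_sum (fun x => complex.Re (f x))|%:E +
                        `|real_sum (fun x => complex.Im (f x))|%:E)).
  by rewrite -EFinD lee_fin; exact: normc_le_ReIm.
have reA : \esum_(x in setT) `|complex.Re (f x)|%:E <=
    \esum_(x in setT) (normc (f x))%:E.
  by apply: le_esum => x _; rewrite lee_fin ler_Re_normc.
have imA : \esum_(x in setT) `|complex.Im (f x)|%:E <=
    \esum_(x in setT) (normc (f x))%:E.
  by apply: le_esum => x _; rewrite lee_fin ler_Im_normc.
rewrite mule_natl mule2n leeD//.
- exact: le_trans (normr_real_sum (le_lt_trans reA foo)) reA.
- exact: le_trans (normr_real_sum (le_lt_trans imA foo)) imA.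
Qed.

Lemma complex_sum_single (f : X -> R[i]) x :
  (forall y, y != x -> f y = 0%R) -> complex_sum f = f x.
Proof.
move=> f0; rewrite /complex_sum !(real_sum_single (x := x)).
- by case: (f x).
- by move=> y /f0 ->.
- by move=> y /f0 ->.
Qed.

End UnorderedSums.

(** * Boundedness of integral operators on weighted l^1 *)

Section Schur.
Variables (R : realType) (X : choiceType) (adj : rel X) (o : X) (q : nat).
Hypothesis q_gt0 : (0 < q)%N.

Local Notation w := (@qweight R X adj o q).

Lemma qweightD s t x : w (s + t) x = w s x * w t x.
Proof.
rewrite /qweight mulrDl opprD powRD//; apply/implyP => _.
by rewrite pnatr_eq0 -lt0n.
Qed.

Lemma qweight_gt0 s x : 0 < w s x.
Proof. by rewrite powR_gt0// ltr0n. Qed.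

Lemma qweight_ge0 s x : 0 <= w s x.
Proof. exact/ltW/qweight_gt0. Qed.

Lemma Lp_normpow1 alpha (f : X -> R[i]) : Lp_normpow adj o q 1 alpha f =
  \esum_(x in setT) (normc (f x) * w alpha x)%:E.
Proof. by apply: eq_esum => x _; rewrite powRr1// normc_ge0. Qed.

Lemma Lp_normpow1_ge0 alpha (f : X -> R[i]) :
  (0 <= Lp_normpow adj o q 1 alpha f)%E.
Proof.
by apply: esum_ge0 => x _; rewrite lee_fin mulr_ge0 ?powR_ge0 ?qweight_ge0.
Qed.

Lemma Lp_norm1 alpha (f : X -> R[i]) :
  Lp_norm adj o q 1 alpha f = fine (Lp_normpow adj o q 1 alpha f).
Proof. by rewrite /Lp_norm invr1 powRr1// fine_ge0// Lp_normpow1_ge0. Qed.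

Variables (N : X -> X -> R) (a b alpha : R).

Lemma normc_op_term f z x : normc (op_term adj o q N b f z x) =
  `|N z x| * normc (f x) * w b x.
Proof.
by rewrite /op_term !normcM !normc_real (ger0_norm (qweight_ge0 _ _)).
Qed.

(** The Schur test at p = 1, with the weights of the operator and of the space
    collected on the two sides. *)
Definition column_bound (C : R) : Prop := forall x,
  (\esum_(z in setT) (`|N z x| * w (alpha + a) z)%:E <=
   (C * w (alpha - b) x)%:E)%E.

(** The operator maps the Dirac function at x to the column of x. *)
Lemma integral_op_bounded_column :
  integral_op_bounded adj o q N a b 1 alpha -> exists C, column_bound C.
Proof.
move=> [C bdd]; exists C => x0.
pose f (x : X) : R[i] := if x == x0 then 1 else 0.
have f0 y : y != x0 -> f y = 0 by rewrite /f => /negbTE ->.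
have fx0 : f x0 = 1 by rewrite /f eqxx.
have fn : Lp_normpow adj o q 1 alpha f = (w alpha x0)%:E.
  rewrite Lp_normpow1 (esum_single (x := x0)).
  - by rewrite fx0 normc1 mul1r.
  - by move=> y /f0 ->; rewrite normc0 mul0r.
  - by rewrite lee_fin mulr_ge0 ?normc_ge0 ?qweight_ge0.
have [|_ Tfoo] := bdd f; first by rewrite /in_Lp fn ltry.
rewrite !Lp_norm1 fn /=.
have TE z : integral_op adj o q N a b f z =
    (w a z * (N z x0 * w b x0))%:C%C.
  rewrite /integral_op (complex_sum_single (x := x0)).
    by rewrite /op_term fx0 mulr1 -!rmorphM.
  by move=> y /f0 fy; rewrite /op_term fy mulr0 mul0r.
have wb0 := qweight_gt0 b x0.
have -> : (\esum_(z in setT) (`|N z x0| * w (alpha + a) z)%:E =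
   (w b x0)^-1%:E * Lp_normpow adj o q 1 alpha (integral_op adj o q N a b f))%E.
  rewrite Lp_normpow1 -esumZl ?invr_ge0 ?qweight_ge0//; last first.
    by move=> x; rewrite lee_fin mulr_ge0 ?normc_ge0 ?qweight_ge0.
  apply: eq_esum => z _; rewrite TE normc_real !normrM.
  rewrite !(ger0_norm (qweight_ge0 _ _)) qweightD -EFinM; congr EFin.
  by field; rewrite gt_eqF.
move: Tfoo; rewrite /in_Lp.
have := Lp_normpow1_ge0 alpha (integral_op adj o q N a b f).
case: (Lp_normpow _ _ _ _ _ _) => [r||]//= _ _ rC.
rewrite lee_fin mulrC ler_pdivrMr// -mulrA -qweightD subrK.
exact: rC.
Qed.

(** By Tonelli, the norm of the image of f is at most the sum over x of |f x|
    times the norm of the column of x. Absolute convergence at z follows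
    because a single entry of a column is bounded by the whole column. *)
Lemma column_bound_integral_op C :
  column_bound C -> integral_op_bounded adj o q N a b 1 alpha.
Proof.
move=> colC; exists (2 * C) => f; rewrite /in_Lp !Lp_norm1 !Lp_normpow1 => foo.
have w0 := qweight_ge0.
have t0 z x : (0 <= (`|N z x| * w (alpha + a) z)%:E)%E.
  by rewrite lee_fin mulr_ge0.
have entry z x : `|N z x| * w (alpha + a) z <= C * w (alpha - b) x.
  rewrite -lee_fin; apply: le_trans (colC x).
  exact: (@esum_ge_term _ _ (fun z => (`|N z x| * w (alpha + a) z)%:E)).
have nf0 x : 0 <= normc (f x) * w alpha x by rewrite mulr_ge0 ?normc_ge0.
have C0 : 0 <= C.
  have /le_trans /(_ (entry o o)) : 0 <= `|N o o| * w (alpha + a) o.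
    by rewrite mulr_ge0.
  by rewrite pmulr_lge0 ?qweight_gt0.
have wE x : w alpha x = w (alpha - b) x * w b x by rewrite -qweightD subrK.
have summ z : abs_summable (op_term adj o q N b f z).
  rewrite /abs_summable.
  apply: (@le_lt_trans _ _ (\esum_(x in setT)
    ((w (alpha + a) z)^-1 * C)%:E * (normc (f x) * w alpha x)%:E)%E).
    apply: le_esum => x _; rewrite lee_fin normc_op_term.
    rewrite -[leRHS]mulrA ler_pdivlMl ?qweight_gt0// wE.
    have := ler_wpM2r (mulr_ge0 (normc_ge0 (f x)) (w0 b x)) (entry z x).
    by congr (_ <= _); ring.
  rewrite esumZl ?mulr_ge0 ?invr_ge0//.
  by rewrite lte_mul_pinfty// lee_fin mulr_ge0 ?invr_ge0.
have main : (\esum_(x in setT)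
    (normc (integral_op adj o q N a b f x) * w alpha x)%:E <=
    (2 * C)%:E * \esum_(x in setT) (normc (f x) * w alpha x)%:E)%E.
  apply: (@le_trans _ _ (\esum_(z in setT) \esum_(x in setT)
      ((2 * normc (f x) * w b x)%:E * (`|N z x| * w (alpha + a) z)%:E))%E).
    apply: le_esum => z _.
    have -> : (\esum_(x in setT) ((2 * normc (f x) * w b x)%:E *
        (`|N z x| * w (alpha + a) z)%:E) = (w (alpha + a) z)%:E *
        (2%:E * \esum_(x in setT) (normc (op_term adj o q N b f z x))%:E))%E.
      rewrite muleA -EFinM -esumZl ?mulr_ge0//; last first.
        by move=> x; rewrite lee_fin normc_ge0.
      apply: eq_esum => x _; rewrite -!EFinM normc_op_term; congr EFin.
      by ring.
    apply: (@le_trans _ _ ((w (alpha + a) z)%:E *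
        (normc (complex_sum (op_term adj o q N b f z)))%:E)%E).
      rewrite -EFinM lee_fin normcM normc_real ger0_norm// qweightD.
      by rewrite le_eqVlt; apply/orP; left; apply/eqP; ring.
    by rewrite lee_wpmul2l ?lee_fin// normc_complex_sum.
  rewrite esum_exchange; last first.
    by move=> z x; rewrite mule_ge0// lee_fin !mulr_ge0 ?normc_ge0.
  rewrite -esumZl ?mulr_ge0//; apply: le_esum => x _.
  rewrite esumZl ?mulr_ge0 ?normc_ge0//.
  apply: (@le_trans _ _ ((2 * normc (f x) * w b x)%:E *
     (C * w (alpha - b) x)%:E)%E).
    by rewrite lee_wpmul2l// lee_fin !mulr_ge0 ?normc_ge0.
  by rewrite -!EFinM lee_fin wE le_eqVlt; apply/orP; left; apply/eqP; ring.
have Too : (\esum_(x in setT)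
    (normc (integral_op adj o q N a b f x) * w alpha x)%:E < +oo)%E.
  apply: le_lt_trans main _; rewrite lte_mul_pinfty//.
  by rewrite lee_fin mulr_ge0.
split => //.
rewrite -lee_fin EFinM !fineK//.
- by rewrite ge0_fin_numE//; apply: esum_ge0 => x _; rewrite lee_fin.
- rewrite ge0_fin_numE//; apply: esum_ge0 => x _; rewrite lee_fin.
  by rewrite mulr_ge0 ?normc_ge0.
Qed.

End Schur.

(** * Geometric sums and powers *)

Section GeometricBounds.
Variable R : realType.
Implicit Types r p C : R.

Lemma natr_bounded_false C : (forall n : nat, n%:R <= C) -> False.
Proof.
move=> nC; have C0 : 0 <= C by apply: le_trans (nC 0%N).
by have := archi_boundP C0; rewrite ltNge nC.
Qed.

Lemma geometric_sum_le r n : 0 <= r < 1 -> \sum_(i < n) r ^+ i <= (1 - r)^-1.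
Proof.
move=> /andP[r0 r1]; rewrite -[leRHS]mul1r ler_pdivlMr ?subr_gt0//.
by rewrite mulrC -[1 - r]opprB mulNr -subrX1 opprB gerBl exprn_ge0.
Qed.

(** Bernoulli's inequality makes the powers of r > 1 unbounded. *)
Lemma expr_bounded_le1 r C : 0 < r -> (forall n, r ^+ n <= C) -> r <= 1.
Proof.
move=> r0 rC; rewrite leNgt; apply/negP => r1.
have bern n : n%:R * (r - 1) <= r ^+ n.
  elim: n => [|n IH]; first by rewrite mul0r expr0.
  have : 1 <= r ^+ n by rewrite exprn_ege1// ltW.
  by rewrite exprS -natr1; move: (r ^+ n) IH => e; nra.
apply: (@natr_bounded_false (C / (r - 1))) => n.
by rewrite ler_pdivlMr ?subr_gt0// (le_trans (bern n)).
Qed.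

(** The extreme terms are r^n and p^n, which forces r, p <= 1; for r = p = 1
    the sum is n + 1; if one of the ratios is < 1, dropping the other factor
    leaves a convergent geometric series. *)
Lemma mixed_geometric_bounded r p : 0 < r -> 0 < p ->
  (exists C, forall n, \sum_(l < n.+1) r ^+ (n - l) * p ^+ l <= C) <->
  [/\ r <= 1, p <= 1 & (r < 1) || (p < 1)].
Proof.
move=> r0 p0; split=> [[C bd]|[r1 p1]].
  have t0 n (l : 'I_n.+1) : 0 <= r ^+ (n - l) * p ^+ l.
    by rewrite mulr_ge0 ?exprn_ge0 ?ltW.
  have r1 : r <= 1.
    apply: (@expr_bounded_le1 r C r0) => n; apply: le_trans (bd n).
    rewrite big_ord_recl subn0 expr0 mulr1 lerDl.
    by apply: sumr_ge0 => l _; exact: t0.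
  have p1 : p <= 1.
    apply: (@expr_bounded_le1 p C p0) => n; apply: le_trans (bd n).
    rewrite big_ord_recr/= subnn expr0 mul1r lerDr.
    by apply: sumr_ge0 => l _; exact: (t0 n (widen_ord (leqnSn n) l)).
  split => //; rewrite !lt_neqAle r1 p1 !andbT -negb_and; apply/negP.
  move=> /andP[/eqP rE /eqP pE]; apply: (@natr_bounded_false C) => n.
  apply: le_trans (bd n); rewrite (eq_bigr (fun=> 1)) => [|l _].
    by rewrite sumr_const card_ord ler_nat.
  by rewrite rE pE !expr1n mulr1.
move=> /orP[rl|pl].
  exists (1 - r)^-1 => n; apply: (@le_trans _ _ (\sum_(l < n.+1) r ^+ l)).
    rewrite [leRHS](reindex_inj rev_ord_inj); apply: ler_sum => l _ /=.
    by rewrite subSS ler_piMr ?exprn_ge0 ?exprn_ile1 ?(ltW r0) ?(ltW p0).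
  by rewrite geometric_sum_le// (ltW r0).
exists (1 - p)^-1 => n; apply: (@le_trans _ _ (\sum_(l < n.+1) p ^+ l)).
  by apply: ler_sum => l _;
    rewrite ler_piMl ?exprn_ge0 ?exprn_ile1 ?(ltW r0) ?(ltW p0).
by rewrite geometric_sum_le// (ltW p0).
Qed.

Lemma powR_le1 (a x : R) : 1 < a -> (a `^ x <= 1) = (x <= 0).
Proof.
move=> a1; rewrite /powR gt_eqF ?(lt_trans ltr01)//.
by rewrite -[X in _ <= X]expR0 ler_expR pmulr_lle0// ln_gt0.
Qed.

Lemma powR_lt1 (a x : R) : 1 < a -> (a `^ x < 1) = (x < 0).
Proof.
move=> a1; rewrite /powR gt_eqF ?(lt_trans ltr01)//.
by rewrite -[X in _ < X]expR0 ltr_expR pmulr_llt0// ln_gt0.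
Qed.

End GeometricBounds.

(** * Ancestors and sectors *)

Section Ancestors.
Variables (X : choiceType) (o : X) (q : nat) (par : X -> X)
  (ch : X -> seq X) (lvl : X -> nat).
Hypothesis T : rooted_tree o q par ch lvl.
Implicit Types (x y z u v : X).

Definition ancestor l x := iter (lvl x - l) par x.

Definition in_sector v x := (lvl v <= lvl x)%N && (ancestor (lvl v) x == v).

Lemma lvl_root : lvl o = 0%N.
Proof. by apply/eqP; rewrite (lvl_eq0 T). Qed.

Lemma lvl_gt0 x : (0 < lvl x)%N = (x != o).
Proof. by rewrite lt0n (lvl_eq0 T). Qed.

Lemma lvl_par_lt x : x != o -> lvl x = (lvl (par x)).+1.
Proof. by rewrite -lvl_gt0 (lvl_par T) => /prednK. Qed.

Lemma lvl_ancestor l x : (l <= lvl x)%N -> lvl (ancestor l x) = l.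
Proof.
move=> lx; rewrite /ancestor -{2}(subKn lx); move: (lvl x - l)%N => k.
by elim: k => [|k IH] /=; rewrite ?subn0// (lvl_par T) IH subnS.
Qed.

Lemma ancestor_lvl x : ancestor (lvl x) x = x.
Proof. by rewrite /ancestor subnn. Qed.

Lemma ancestor0 x : ancestor 0 x = o.
Proof. by apply/eqP; rewrite -(lvl_eq0 T) lvl_ancestor. Qed.

Lemma par_ancestor l x : (l < lvl x)%N -> par (ancestor l.+1 x) = ancestor l x.
Proof. by move=> lx; rewrite /ancestor -iterS -subSn// subSS. Qed.

Lemma ancestor_par l x : (l < lvl x)%N -> ancestor l (par x) = ancestor l x.
Proof.
by move=> lx; rewrite /ancestor (lvl_par T) -iterSr -subSn ?prednK//;
  case: lvl lx.
Qed.

Lemma ancestor_ancestor l m x : (l <= m <= lvl x)%N ->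
  ancestor l (ancestor m x) = ancestor l x.
Proof.
move=> /andP[lm mx]; rewrite {1}/ancestor lvl_ancestor// /ancestor -iterD.
by congr (iter _ par x); lia.
Qed.

Lemma ancestor_root l x : (0 < l <= lvl x)%N -> ancestor l x != o.
Proof. by move=> /andP[l0 lx]; rewrite -lvl_gt0 lvl_ancestor. Qed.

Lemma in_sector_root x : in_sector o x.
Proof. by rewrite /in_sector lvl_root/= ancestor0. Qed.

Lemma in_sector_lvl v x : lvl x = lvl v -> in_sector v x = (x == v).
Proof. by move=> xv; rewrite /in_sector -xv leqnn ancestor_lvl. Qed.

(** Below the level of v, membership in the sector of v passes between parent
    and child, which is what allows sums over sectors to be computed level by
    level. *)
Lemma in_sector_par v x : (lvl v < lvl x)%N -> in_sector v (par x) =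
  in_sector v x.
Proof.
move=> vx; rewrite /in_sector ancestor_par// (lvl_par T) (ltnW vx).
by have -> : (lvl v <= (lvl x).-1)%N by lia.
Qed.

Lemma in_sector_ch v x y : y \in ch x -> (lvl v <= lvl x)%N ->
  in_sector v y = in_sector v x.
Proof.
move=> yx vx; rewrite -in_sector_par; last by rewrite (lvl_ch T yx).
by move: yx; rewrite (mem_ch T) => /andP[_ /eqP ->].
Qed.

Lemma in_sector_sub u x : u != o -> in_sector u x -> in_sector (par u) x.
Proof.
move=> uo /andP[ux /eqP ax]; move: (lvl_par_lt uo) => uE.
rewrite /in_sector -par_ancestor -?uE// ax eqxx andbT; lia.
Qed.

Lemma in_sector_ancestor l x : (l <= lvl x)%N -> in_sector (ancestor l x) x.
Proof. by move=> lx; rewrite /in_sector lvl_ancestor// lx /=. Qed.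

Lemma in_sectorE l z x : (l <= lvl z)%N ->
  in_sector (ancestor l z) x = (l <= lvl x)%N && (ancestor l z == ancestor l x).
Proof. by move=> lz; rewrite /in_sector lvl_ancestor// eq_sym. Qed.

End Ancestors.

(** * Harmonic functions and sectors *)

Section Kappa.
Variables (R : realType) (q : nat).
Hypothesis q_ge2 : (2 <= q)%N.

Local Notation Q := (q%:R : R).

Let Q_gt0 : 0 < Q. Proof. by rewrite ltr0n; case: q q_ge2. Qed.
Let Q_neq0 : Q != 0. Proof. by rewrite gt_eqF. Qed.
Let Q_ge2 : 2 <= Q. Proof. by rewrite ler_nat. Qed.

(** The solution of q kappa(n+2) + kappa(n) = (q + 1) kappa(n+1) with kappa(0)
    = 0 and kappa(1) = 1: the values of a harmonic function that depends only
    on the distance n below a vertex at which it vanishes. *)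
Definition kappa (n : nat) : R := \sum_(i < n) Q ^- i.

Lemma kappa0 : kappa 0 = 0.
Proof. by rewrite /kappa big_ord0. Qed.

Lemma kappaS n : kappa n.+1 = kappa n + Q ^- n.
Proof. by rewrite /kappa big_ord_recr. Qed.

Lemma kappa_rec n : kappa n.+1 = 1 + kappa n / Q.
Proof.
elim: n => [|n IH]; first by rewrite kappaS kappa0 mul0r addr0 add0r invr1.
by rewrite kappaS {1}IH [in RHS]kappaS mulrDl addrA exprS invfM [Q^-1 * _]mulrC.
Qed.

Lemma kappa1 : kappa 1 = 1.
Proof. by rewrite kappa_rec kappa0 mul0r addr0. Qed.

Lemma kappa_ge0 n : 0 <= kappa n.
Proof. by apply: sumr_ge0 => i _; rewrite invr_ge0 exprn_ge0// ltW. Qed.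

Lemma kappa_ge1 n : 1 <= kappa n.+1.
Proof. by rewrite kappa_rec lerDl divr_ge0 ?kappa_ge0// ltW. Qed.

Lemma kappa_le2 n : kappa n <= 2.
Proof.
elim: n => [|n IH]; first by rewrite kappa0.
rewrite kappa_rec [leRHS](_ : 2 = 1 + 1)// lerD2l ler_pdivrMr// mul1r.
exact: le_trans IH Q_ge2.
Qed.

(** Since kappa(n - l) = 1 + kappa(n - l - 1) / q, the l-th term is a(l+1) plus
    the difference of kappa(n - j) a(j) / q between j = l + 1 and j = l. The
    boundary values vanish because a(0) = 0 and kappa(0) = 0. *)
Lemma kappa_telescope (a : nat -> R) n : a 0%N = 0 ->
  \sum_(l < n) kappa (n - l) * (a l.+1 - a l / Q) = \sum_(l < n) a l.+1.
Proof.
move=> a0.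
pose F l := kappa (n - l) * a l / Q.
rewrite (eq_bigr (fun l : 'I_n => a l.+1 + (F l.+1 - F l))); last first.
  move=> l _; rewrite /F -[(n - l)%N]prednK ?subn_gt0// -subnS kappa_rec.
  by field.
rewrite big_split/= -(big_mkord xpredT (fun l => F l.+1 - F l))
  telescope_sumr//.
by rewrite /F subnn kappa0 a0 mulr0 !mul0r subrr addr0.
Qed.

End Kappa.

Section Harmonic.
Variables (R : realType) (X : choiceType) (o : X) (q : nat) (par : X -> X)
  (ch : X -> seq X) (lvl : X -> nat).
Hypothesis T : rooted_tree o q par ch lvl.
Hypothesis q_ge2 : (2 <= q)%N.
Implicit Types (x y z u v : X) (g : X -> R).

Local Notation Q := (q%:R : R).
Local Notation sphere := (sphere ch o).
Local Notation tree_ball := (tree_ball ch o).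
Local Notation kappa := (kappa R q).
Local Notation ancestor := (ancestor par lvl).
Local Notation in_sector := (in_sector par lvl).

Definition child_count v : R := (size (ch v))%:R.

Definition increment g x := g x - g (par x).

(** The mean value property, multiplied by q + 1. *)
Definition rooted_harmonic g := forall x,
  \sum_(y <- ch x) g y + (if x == o then 0 else g (par x)) = q.+1%:R * g x.

(** The component of the kernel attached to the child u of v = par u: radial in
    the sector of v with values of mean zero over the children of v. Truncated
    subtraction and kappa(0) = 0 make it vanish at v and above. *)
Definition basis_fun u x : R := kappa (lvl x - lvl (par u)) *
  ((in_sector u x)%:R - (in_sector (par u) x)%:R / child_count (par u)).

Let Q_gt0 : 0 < Q. Proof. by rewrite ltr0n; case: q q_ge2. Qed.
Let Q_neq0 : Q != 0. Proof. by rewrite gt_eqF. Qed.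
Let Q_ge2 : 2 <= Q. Proof. by rewrite ler_nat. Qed.

Lemma child_count_root : child_count o = q.+1%:R.
Proof. by rewrite /child_count (size_ch T) eqxx. Qed.

Lemma child_count_neq x : x != o -> child_count x = Q.
Proof. by rewrite /child_count (size_ch T) => /negbTE ->. Qed.

Lemma child_count_ge2 x : 2 <= child_count x.
Proof.
by rewrite /child_count ler_nat (size_ch T); case: ifP => // _; exact: leqW.
Qed.

Lemma child_count_neq0 x : child_count x != 0.
Proof. by rewrite gt_eqF// (lt_le_trans _ (child_count_ge2 x)). Qed.

Lemma child_count_le x : child_count x <= 2 * Q.
Proof.
rewrite /child_count (size_ch T) -natrM ler_nat; case: ifP => _; lia.
Qed.

Lemma increment_root g : increment g o = 0.
Proof. by rewrite /increment (par_root T) subrr. Qed.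

Lemma harmonic_ch g x : rooted_harmonic g ->
  \sum_(y <- ch x) g y = child_count x * g x + increment g x.
Proof.
move=> /(_ x); have [->|xo] := eqVneq x o.
  by rewrite increment_root !addr0 child_count_root.
by rewrite child_count_neq// /increment -natr1 => /(canRL (addrK _)) ->; ring.
Qed.

(** The mean value property says that the increments of a harmonic function
    form a finitely additive measure on the boundary of the tree: the mass of a
    vertex is shared among its children. *)
Lemma increment_ch g x : rooted_harmonic g -> \sum_(y <- ch x) increment g y =
  increment g x.
Proof.
move=> gh; rewrite /increment sumrB harmonic_ch// (eq_big_seq (fun=> g x)).
  by rewrite big_const_seq count_predT iter_addr addr0 -mulr_natl addrAC subrr
    add0r.
by move=> y; rewrite (mem_ch T) => /andP[_ /eqP ->].
Qed.

Lemma sum_sector0 g v :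
  \sum_(x <- sphere (lvl v) | in_sector v x) g x = g v.
Proof.
rewrite big_mkcond/= (bigD1_seq v)/= ?(mem_sphere T) ?(uniq_sphere T)//.
rewrite in_sector_lvl// eqxx big_seq_cond big1 ?addr0// => x.
by rewrite (mem_sphere T) => /andP[/eqP xv /negbTE xv'];
  rewrite in_sector_lvl// xv'.
Qed.

Lemma sum_sectorS g v n :
  \sum_(x <- sphere (lvl v + n).+1 | in_sector v x) g x =
  \sum_(y <- sphere (lvl v + n) | in_sector v y) \sum_(x <- ch y) g x.
Proof.
rewrite big_mkcond sum_sphereS [RHS]big_mkcond; apply: eq_big_seq => y.
rewrite (mem_sphere T) => /eqP yv.
rewrite (eq_big_seq (fun x => if in_sector v y then g x else 0)); last first.
  by move=> x xy; rewrite (in_sector_ch T xy)// yv leq_addr.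
by case: ifP => // _; rewrite big1.
Qed.

Lemma sum_sector_increment g v n : rooted_harmonic g ->
  \sum_(x <- sphere (lvl v + n) | in_sector v x) increment g x = increment g v.
Proof.
move=> gh; elim: n => [|n IH]; first by rewrite addn0 sum_sector0.
rewrite addnS sum_sectorS -[RHS]IH; apply: eq_bigr => y _.
exact: increment_ch.
Qed.

(** By induction on the level: each vertex y below v has q children, and g sums
    to q g(y) plus the increment of y over them; the increments on a level of
    the sector add up to that of v. *)
Lemma sum_sector g v n : rooted_harmonic g ->
  \sum_(x <- sphere (lvl v + n.+1) | in_sector v x) g x =
  Q ^+ n * (child_count v * g v + increment g v * kappa n.+1).
Proof.
move=> gh; elim: n => [|n IH].
  rewrite addnS sum_sectorS addn0 expr0 mul1r (kappa1 R q) mulr1.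
  by rewrite (sum_sector0 (fun y => \sum_(x <- ch y) g x)) harmonic_ch.
rewrite addnS sum_sectorS.
rewrite (eq_bigr _ (fun y _ => harmonic_ch y gh)) big_split/=
  sum_sector_increment//.
rewrite big_seq_cond (eq_bigr (fun y => Q * g y)); last first.
  move=> y /andP[]; rewrite (mem_sphere T) => /eqP yv _.
  by rewrite child_count_neq// -(lvl_gt0 T) yv addnS.
rewrite -big_seq_cond -big_distrr/= IH (kappaS R q n.+1) exprS.
by field; rewrite Q_neq0 expf_neq0.
Qed.

(** For u != o the formula extends to level 0, because kappa(n + 2) - 1 =
    kappa(n + 1) / q. *)
Lemma sum_sector_child g u n : u != o -> rooted_harmonic g ->
  \sum_(x <- sphere (lvl u + n) | in_sector u x) g x =
  Q ^+ n * (g u + increment g u * (kappa n.+1 - 1)).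
Proof.
move=> uo gh; case: n => [|n].
  by rewrite addn0 sum_sector0 (kappa1 R q) subrr mulr0 addr0 mul1r.
by rewrite sum_sector// child_count_neq// (kappa_rec R q n.+1) exprS; field.
Qed.

Lemma harmonic_cst (k : R) : rooted_harmonic (fun=> k).
Proof.
move=> x; rewrite big_const_seq count_predT iter_addr addr0 (size_ch T).
by case: ifP => _; rewrite mulr_natl ?addr0// mulrSr.
Qed.

Lemma harmonicD f g : rooted_harmonic f -> rooted_harmonic g ->
  rooted_harmonic (f \+ g).
Proof.
move=> fh gh x; rewrite big_split/= mulrDr -fh -gh.
by case: ifP => _; rewrite ?addr0// addrACA.
Qed.

Lemma harmonicZ (k : R) g : rooted_harmonic g ->
  rooted_harmonic (fun x => k * g x).
Proof.
move=> gh x; rewrite -big_distrr/= mulrCA -gh mulrDr.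
by case: ifP => _; rewrite ?mulr0.
Qed.

Lemma harmonic_sum n (f : nat -> X -> R) :
  (forall i, (i < n)%N -> rooted_harmonic (f i)) ->
    rooted_harmonic (fun x => \sum_(i < n) f i x).
Proof.
elim: n => [|n IH] fh.
  rewrite (_ : (fun _ => _) = fun=> 0); first exact: harmonic_cst.
  by apply/funext => x; rewrite big_ord0.
rewrite (_ : (fun _ => _) = (fun x => \sum_(i < n) f i x) \+ f n).
  by apply: harmonicD; [apply: IH => i /ltnW/fh|exact: fh].
by apply/funext => x; rewrite big_ord_recr.
Qed.

Lemma basis_fun0 u x : (lvl x <= lvl (par u))%N -> basis_fun u x = 0.
Proof. by rewrite -subn_eq0 /basis_fun => /eqP ->; rewrite kappa0 mul0r. Qed.

(** Strictly below v = par u both indicators are constant on each vertex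
    together with its children, and the recurrence of kappa applies; at v
    itself the sum over the children of (1 if it is u, else 0) - 1 / N is 0;
    elsewhere all values are 0. *)
Lemma harmonic_basis_fun u : u != o -> rooted_harmonic (basis_fun u).
Proof.
move=> uo x; have uE := lvl_par_lt T uo.
have [xv|xv|xv] := ltngtP (lvl x) (lvl (par u)).
- rewrite big_seq big1 ?add0r; last first.
    by move=> y /(lvl_ch T) yx; rewrite basis_fun0// yx.
  rewrite !basis_fun0 ?mulr0 ?if_same ?(lvl_par T)//; first by lia.
  by move: xv; rewrite (lvl_par T); lia.
- set I := (in_sector u x)%:R - (in_sector (par u) x)%:R / child_count (par u).
  have xo : x != o by rewrite -(lvl_gt0 T); lia.
  have [n xn] : exists n, lvl x = (lvl (par u) + n.+1)%N.
    by exists (lvl x - lvl (par u)).-1; lia.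
  rewrite (eq_big_seq (fun=> kappa n.+2 * I)); last first.
    move=> y yx; rewrite /basis_fun (lvl_ch T yx) !(in_sector_ch T yx) ?uE//;
      last exact: ltnW.
    by congr (kappa _ * _); lia.
  rewrite big_const_seq count_predT iter_addr addr0 (size_ch T) (negbTE xo).
  have -> : basis_fun u x = kappa n.+1 * I by rewrite /basis_fun xn addKn.
  have -> : basis_fun u (par x) = kappa n * I.
    case: n xn => [|n] xn.
      by rewrite kappa0 mul0r basis_fun0// [lvl (par x)](lvl_par T) xn addn1.
    rewrite /basis_fun !(in_sector_par T)//; last by rewrite xn uE; lia.
    by congr (kappa _ * _); rewrite [lvl (par x)](lvl_par T) xn; lia.
  by rewrite -mulr_natl (kappa_rec R q n.+1) (kappa_rec R q n) -natr1; field.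
- rewrite (@basis_fun0 u x) ?xv// mulr0.
  rewrite (@basis_fun0 u (par x)) ?if_same ?addr0;
    last by rewrite (lvl_par T) xv; lia.
  rewrite (eq_big_seq (fun y =>
    (y == u)%:R - (x == par u)%:R / child_count (par u))).
    rewrite sumrB big_const_seq count_predT iter_addr addr0.
    have -> : \sum_(y <- ch x) (y == u)%:R = (count_mem u (ch x))%:R :> R.
      rewrite -sum1_count natr_sum [RHS]big_mkcond; apply: eq_bigr => y _ /=.
      by case: (y == u).
    rewrite count_uniq_mem ?(uniq_ch T)//.
    rewrite (mem_ch T) uo eq_sym; case: eqP => [->|_];
      last by rewrite mul0r mul0rn subrr.
    by rewrite -(mulr_natl (_ / _)) mul1r mulfV ?subrr// child_count_neq0.
  move=> y yx; rewrite /basis_fun (in_sector_ch T (v := par u) yx) ?xv//.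
  rewrite (in_sector_lvl par xv) in_sector_lvl;
    last by rewrite (lvl_ch T yx) xv -uE.
  by rewrite (lvl_ch T yx) xv subSnn (kappa1 R q) mul1r.
Qed.

Lemma basis_fun_le u x : u != o ->
  `|basis_fun u x| <= 2 * (in_sector (par u) x)%:R.
Proof.
move=> uo; rewrite /basis_fun normrM ger0_norm ?kappa_ge0//.
rewrite ler_pM ?kappa_ge0 ?kappa_le2//.
have := in_sector_sub T uo (x := x); have := child_count_ge2 (par u);
  move: (child_count _) => N N2.
have N0 : 0 <= N^-1 by rewrite invr_ge0; lra.
have N1 : N^-1 <= 1 by rewrite invf_le1; lra.
case: (in_sector u x) => [/(_ isT) ->|_]; last case: (in_sector (par u) x).
- by rewrite /= ler_norml mul1r; apply/andP; split; lra.
- by rewrite /= ler_norml mul1r; apply/andP; split; lra.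
- by rewrite /= mul0r subrr normr0.
Qed.

(** Subtracting from the level sum over the sector of u the 1/N-th part of the
    level sum over the sector of its parent cancels the values of g and leaves
    only increments. Division by q instead of N is harmless: the two differ
    only at the root, where the increment is 0. *)
Lemma sum_sphere_basis_fun g u n : u != o -> rooted_harmonic g ->
  \sum_(x <- sphere (lvl u + n)) g x * basis_fun u x =
  Q ^+ n * kappa n.+1 ^+ 2 * (increment g u - increment g (par u) / Q).
Proof.
move=> uo gh; have uE := lvl_par_lt T uo.
rewrite (eq_big_seq (fun x => kappa n.+1 * ((if in_sector u x then g x else 0) -
   (child_count (par u))^-1 * (if in_sector (par u) x then g x else 0))));
     last first.
  move=> x; rewrite (mem_sphere T) => /eqP xn.
  rewrite /basis_fun xn uE addSn -addnS addKn.
  by do 2 case: ifP => _ /=; field; rewrite child_count_neq0.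
rewrite -big_distrr sumrB/= -big_distrr/= -!big_mkcond sum_sector_child//.
rewrite uE addSn -addnS sum_sector//.
have -> : increment g (par u) / Q = increment g (par u) / child_count (par u).
  have [->|vo] := eqVneq (par u) o; first by rewrite increment_root !mul0r.
  by rewrite child_count_neq.
have -> : g u = increment g u + g (par u) by rewrite subrK.
by field; rewrite child_count_neq0.
Qed.

Lemma sum_sphere_basis_fun0 g u k : (k <= lvl (par u))%N ->
  \sum_(x <- sphere k) g x * basis_fun u x = 0.
Proof.
move=> ku; rewrite big_seq big1// => x; rewrite (mem_sphere T) => /eqP xk.
by rewrite basis_fun0 ?mulr0// xk.
Qed.

(** The mean value property on spheres: the increment at the root is 0. *)
Lemma sum_sphere_harmonic g k : rooted_harmonic g ->
  \sum_(x <- sphere k) g x = g o * \sum_(x <- sphere k) 1.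
Proof.
have E f : \sum_(x <- sphere k) f x =
  \sum_(x <- sphere (lvl o + k) | in_sector o x) f x :> R.
  by rewrite (lvl_root T); apply: eq_bigl => x; rewrite (in_sector_root T).
move=> gh; rewrite !E; case: k {E} => [|k].
  by rewrite addn0 !sum_sector0 mulr1.
rewrite !sum_sector ?increment_root//; last exact: harmonic_cst.
by rewrite /increment; ring.
Qed.

Lemma sum_increment_ancestor g z :
  \sum_(l < lvl z) increment g (ancestor l.+1 z) = g z - g o.
Proof.
rewrite (eq_bigr (fun l : 'I_(lvl z) =>
  g (ancestor l.+1 z) - g (ancestor l z))).
  rewrite -(big_mkord xpredT (fun l => g (ancestor l.+1 z) - g (ancestor l z))).
  by rewrite (telescope_sumr (fun l => g (ancestor l z)))// (ancestor0 T)
    ancestor_lvl.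
by move=> l _; rewrite /increment par_ancestor.
Qed.

Lemma sum_sector1_le v n : \sum_(x <- sphere (lvl v + n) | in_sector v x) 1 <=
  2 * Q ^+ n.
Proof.
case: n => [|n]; first by rewrite addn0 sum_sector0 expr0 mulr1 ler1n.
rewrite sum_sector; last exact: harmonic_cst.
rewrite /increment subrr mul0r addr0 mulr1 (_ : 2 * _ = Q ^+ n * (2 * Q));
  last first.
  by rewrite exprS; ring.
by rewrite ler_wpM2l ?exprn_ge0 ?child_count_le// ltW.
Qed.

(** A sector has at most 2 q^n vertices n levels below its top; the factor 2
    accounts for the extra child of the root. *)
Lemma sum_sector_weight_le (s : R) v N : 0 < s -> Q * s < 1 ->
  \sum_(x <- tree_ball N) (in_sector v x)%:R * s ^+ lvl x <=
  2 * (1 - Q * s)^-1 * s ^+ lvl v.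
Proof.
move=> s0 s1.
apply: (@le_trans _ _
  (\sum_(x <- tree_ball (lvl v + N)) (in_sector v x)%:R * s ^+ lvl x)).
  apply: (sum_exhaustion_homo (uniq_tree_ball T) (homo_tree_ball T));
    last exact: leq_addl.
  by move=> x; rewrite mulr_ge0 ?exprn_ge0// ltW.
rewrite sum_tree_ball big_split_ord/= big1 ?add0r; last first.
  move=> k _; rewrite big_seq big1// => x; rewrite (mem_sphere T) => /eqP xk.
  by rewrite /in_sector xk leqNgt ltn_ord mul0r.
rewrite [leRHS]mulrC [leRHS]mulrA.
apply: (@le_trans _ _ (\sum_(k < N) s ^+ lvl v * 2 * (Q * s) ^+ k)).
  apply: ler_sum => k _.
  have -> : \sum_(x <- sphere (lvl v + k)) (in_sector v x)%:R * s ^+ lvl x =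
      s ^+ (lvl v + k) * \sum_(x <- sphere (lvl v + k) | in_sector v x) 1.
    rewrite big_distrr/= [RHS]big_mkcond; apply: eq_big_seq => x.
    by rewrite (mem_sphere T) => /eqP ->; case: ifP => _ /=;
      rewrite ?mul0r ?mul1r ?mulr1.
  apply: (le_trans (ler_wpM2l _ (sum_sector1_le v k)));
    first by rewrite exprn_ge0// ltW.
  by rewrite exprD exprMn le_eqVlt; apply/orP; left; apply/eqP; ring.
rewrite -big_distrr/= ler_wpM2l ?geometric_sum_le//.
  by rewrite mulr_ge0// exprn_ge0// ltW.
by rewrite s1 mulr_ge0 ?(ltW s0) ?(ltW Q_gt0).
Qed.

End Harmonic.

(** * The reproducing kernel *)

Section Kernel.
Variables (R : realType) (X : choiceType) (o : X) (q : nat) (par : X -> X)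
  (ch : X -> seq X) (lvl : X -> nat) (rho : R).
Hypothesis T : rooted_tree o q par ch lvl.
Hypothesis q_ge2 : (2 <= q)%N.
Hypotheses (rho_gt0 : 0 < rho) (rho_lt : q%:R * rho < 1).
Implicit Types (x y z u v : X) (g : X -> R).

Local Notation Q := (q%:R : R).
Local Notation sphere := (sphere ch o).
Local Notation tree_ball := (tree_ball ch o).
Local Notation kappa := (kappa R q).
Local Notation ancestor := (ancestor par lvl).
Local Notation in_sector := (in_sector par lvl).
Local Notation increment := (increment par).
Local Notation rooted_harmonic := (rooted_harmonic o q par ch).
Local Notation basis_fun := (basis_fun R q par ch lvl).

(** The squared norm of kappa over the sector of a child, normalised to a
    parent at level 0 and cut off after m levels. *)
Definition gram_partial m : R :=
  \sum_(n < m) Q ^+ n * kappa n.+1 ^+ 2 * rho ^+ n.+1.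

Definition gram : R := limn gram_partial.

(** The squared norm of the constant 1, cut off at a ball. *)
Definition mass_partial N : R := \sum_(x <- tree_ball N) rho ^+ lvl x.

Definition mass : R := limn mass_partial.

(** The kernel of the weight rho ^ |x|, expanded along the geodesic from o to
    z: the projection to the constants plus one term for each edge of the
    geodesic. *)
Definition sector_kernel z x : R := mass^-1 + gram^-1 *
  \sum_(l < lvl z)
    rho ^- l * kappa (lvl z - l) * basis_fun (ancestor l.+1 z) x.

Let Q_gt0 : 0 < Q. Proof. by rewrite ltr0n; case: q q_ge2. Qed.

Lemma cvgn_limn_bounded (f : nat -> R) M : nondecreasing_seq f ->
  (forall n, f n <= M) -> f @ \oo --> limn f /\ (forall n, f n <= limn f).
Proof.
move=> fh fM; have cf : cvgn f.
  by apply: nondecreasing_is_cvgn => //; exists M => _ [n _ <-].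
by split => //; exact: nondecreasing_cvgn_le.
Qed.

Lemma gram_partial_le m : gram_partial m <= 4 * rho * (1 - Q * rho)^-1.
Proof.
apply: (@le_trans _ _ (\sum_(n < m) 4 * rho * (Q * rho) ^+ n)).
  apply: ler_sum => n _; rewrite (exprS rho) exprMn.
  have k2 : kappa n.+1 ^+ 2 <= 4.
    have := kappa_le2 R q_ge2 n.+1; have := kappa_ge0 R q n.+1.
    by move: (kappa _) => k k0 k2; nra.
  have -> : 4 * rho * (Q ^+ n * rho ^+ n) =
    (Q ^+ n * (rho * rho ^+ n)) * 4 by ring.
  rewrite (_ : Q ^+ n * _ * _ = (Q ^+ n * (rho * rho ^+ n)) * kappa n.+1 ^+
    2); last by ring.
  rewrite ler_wpM2l//.
  by rewrite !mulr_ge0 ?exprn_ge0 ?(ltW rho_gt0) ?(ltW Q_gt0).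
rewrite -big_distrr/= ler_wpM2l ?mulr_ge0 ?(ltW rho_gt0)//.
by rewrite geometric_sum_le// rho_lt mulr_ge0 ?(ltW rho_gt0) ?(ltW Q_gt0).
Qed.

Lemma gram_partial_homo : nondecreasing_seq gram_partial.
Proof.
apply/nondecreasing_seqP => n; rewrite /gram_partial big_ord_recr/= lerDl.
by rewrite !mulr_ge0 ?exprn_ge0 ?kappa_ge0 ?(ltW rho_gt0) ?(ltW Q_gt0).
Qed.

Lemma cvg_gram : gram_partial @ \oo --> gram.
Proof. by have [] := cvgn_limn_bounded gram_partial_homo gram_partial_le. Qed.

Lemma gram_gt0 : 0 < gram.
Proof.
have [_ /(_ 1%N)] := cvgn_limn_bounded gram_partial_homo gram_partial_le.
apply: lt_le_trans; rewrite /gram_partial big_ord1 kappa1//.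
by rewrite expr1n !mul1r expr1.
Qed.

Lemma mass_partial_le N : mass_partial N <= 2 * (1 - Q * rho)^-1.
Proof.
have := sum_sector_weight_le T q_ge2 o N rho_gt0 rho_lt.
rewrite (lvl_root T) expr0 mulr1; apply: le_trans; rewrite le_eqVlt; apply/orP.
left; apply/eqP; apply: eq_bigr => x _.
by rewrite (in_sector_root T) mul1r.
Qed.

Lemma mass_partial_homo : nondecreasing_seq mass_partial.
Proof.
apply: (sum_exhaustion_homo (uniq_tree_ball T) (homo_tree_ball T)) => x.
by rewrite exprn_ge0// ltW.
Qed.

Lemma cvg_mass : mass_partial @ \oo --> mass.
Proof. by have [] := cvgn_limn_bounded mass_partial_homo mass_partial_le. Qed.

Lemma mass_gt0 : 0 < mass.
Proof.
have [_ /(_ 1%N)] := cvgn_limn_bounded mass_partial_homo mass_partial_le.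
apply: lt_le_trans; rewrite /mass_partial sum_tree_ball big_ord1 sum_sphere0.
by rewrite exprn_gt0.
Qed.

Lemma harmonic_sector_kernel z : rooted_harmonic (sector_kernel z).
Proof.
apply: (harmonicD (f := fun=> mass^-1)); first exact: (harmonic_cst T).
apply: harmonicZ; apply: (harmonic_sum T (f := fun l x =>
  rho ^- l * kappa (lvl z - l) * basis_fun (ancestor l.+1 z) x)) => l lz.
apply: harmonicZ; apply: harmonic_basis_fun => //.
by apply: (ancestor_root T); rewrite lz.
Qed.

(** The pairing of g with a basis function over a ball: the increments factor
    out and the remaining sum over levels depends only on how far the ball
    reaches below u. *)
Lemma sum_tree_ball_basis_fun g u N : u != o -> rooted_harmonic g ->
  \sum_(x <- tree_ball N) g x * basis_fun u x * rho ^+ lvl x =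
  rho ^+ lvl (par u) * (increment g u - increment g (par u) / Q) *
    gram_partial (N - lvl u).
Proof.
move=> uo gh; have uE := lvl_par_lt T uo; rewrite sum_tree_ball.
have sphE k : \sum_(x <- sphere k) g x * basis_fun u x * rho ^+ lvl x =
    rho ^+ k * \sum_(x <- sphere k) g x * basis_fun u x.
  rewrite big_distrr; apply: eq_big_seq => x /=.
  by rewrite (mem_sphere T) => /eqP ->; rewrite mulrC.
have [Nu|/ltnW uN] := leqP N (lvl u).
  move: (Nu); rewrite -subn_eq0 => /eqP ->;
    rewrite /gram_partial big_ord0 mulr0.
  rewrite big1// => k _; rewrite sphE sum_sphere_basis_fun0// ?mulr0//.
  by have := ltn_ord k; lia.
have [m ->] : exists m, N = (lvl u + m)%N by exists (N - lvl u)%N; lia.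
rewrite addKn big_split_ord/= big1 ?add0r; last first.
  move=> k _; rewrite sphE sum_sphere_basis_fun0// ?mulr0//.
  by have := ltn_ord k; lia.
rewrite /gram_partial big_distrr; apply: eq_bigr => n _ /=.
by rewrite sphE (sum_sphere_basis_fun T)// uE addSn -addnS exprD; ring.
Qed.

Lemma cvg_sum_linear n (a : 'I_n -> R) (f : 'I_n -> nat -> R) (L : R) :
  (forall i, f i @ \oo --> L) ->
  (fun N => \sum_(i < n) a i * f i N) @ \oo --> (\sum_(i < n) a i) * L.
Proof.
elim: n a f => [|n IH] a f fL.
  rewrite big_ord0 mul0r.
  rewrite (_ : (fun _ => _) = fun=> 0); first exact: cvg_cst.
  by apply/funext => N; rewrite big_ord0.
rewrite (_ : (fun _ => _) =
  (fun N => \sum_(i < n) a (widen_ord (leqnSn n) i) * f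
    (widen_ord (leqnSn n) i) N) \+
  (fun N => a ord_max * f ord_max N)); last first.
  by apply/funext => N; rewrite big_ord_recr.
rewrite big_ord_recr mulrDl; apply: cvgD; first by apply: IH => i; exact: fL.
by apply: cvgMl_tmp; exact: fL.
Qed.

(** Over a ball, each term of the kernel contributes a fixed combination of
    increments of g times a partial sum that tends to mass or gram; in the
    limit the increments along the geodesic from o to z telescope to g z - g o.
    *)
Lemma cvg_sector_kernel g z : rooted_harmonic g ->
  (fun N => \sum_(x <- tree_ball N) g x * sector_kernel z x * rho ^+ lvl x) @
    \oo --> g z.
Proof.
move=> gh.
pose a (l : 'I_(lvl z)) := kappa (lvl z - l) *
  (increment g (ancestor l.+1 z) - increment g (ancestor l z) / Q).
have E N : \sum_(x <- tree_ball N) g x * sector_kernel z x * rho ^+ lvl x =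
    mass^-1 * g o * mass_partial N +
    gram^-1 * \sum_(l < lvl z) a l * gram_partial (N - l.+1).
  rewrite (eq_bigr (fun x => mass^-1 * (g x * rho ^+ lvl x) +
    gram^-1 * \sum_(l < lvl z) (rho ^- l * kappa (lvl z - l)) *
      (g x * basis_fun (ancestor l.+1 z) x * rho ^+ lvl x))); last first.
    move=> x _; rewrite /sector_kernel; set S := \sum_(_ < _) _;
      set S' := \sum_(_ < _) _.
    suff -> : S' = S * (g x * rho ^+ lvl x) by ring.
    by rewrite big_distrl; apply: eq_bigr => l _ /=; ring.
  rewrite big_split/= -!big_distrr/= exchange_big/=; congr (_ + _ * _).
    rewrite -mulrA; congr (_ * _);
      rewrite /mass_partial !sum_tree_ball big_distrr.
    apply: eq_bigr => k _ /=.
    rewrite (eq_big_seq (fun x => rho ^+ k * g x)); last first.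
      by move=> x; rewrite (mem_sphere T) => /eqP ->; rewrite mulrC.
    rewrite -big_distrr/= (sum_sphere_harmonic T q_ge2)// [LHS]mulrCA;
      congr (_ * _).
    rewrite big_distrr; apply: eq_big_seq => x /=.
    by rewrite (mem_sphere T) => /eqP ->; rewrite mulr1.
  apply: eq_bigr => l _; rewrite -big_distrr/= sum_tree_ball_basis_fun//;
    last first.
    by apply: (ancestor_root T); exact: ltn_ord.
  rewrite (par_ancestor par (ltn_ord l))// (lvl_ancestor T)
    ?(ltnW (ltn_ord l))//.
  rewrite (lvl_ancestor T)// /a.
  by field; rewrite expf_neq0 ?gt_eqF.
rewrite (_ : (fun _ => _) = (fun N => mass^-1 * g o * mass_partial N +
    gram^-1 * \sum_(l < lvl z) a l * gram_partial (N - l.+1)));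
      last exact/funext.
have -> : g z = mass^-1 * g o * mass + gram^-1 * ((\sum_l a l) * gram).
  have -> : \sum_l a l = g z - g o.
    rewrite -(sum_increment_ancestor T) (kappa_telescope q_ge2
      (a := fun l => increment g (ancestor l z)))//.
    by rewrite (ancestor0 T) (increment_root T).
  by field; rewrite !gt_eqF ?mass_gt0 ?gram_gt0.
apply: cvgD; first by apply: cvgMl_tmp; exact: cvg_mass.
apply: cvgMl_tmp; apply:
  (cvg_sum_linear (f := fun l N => gram_partial (N - l.+1))).
by move=> l; rewrite cvg_centern; exact: cvg_gram.
Qed.

Lemma sector_kernel_root z : sector_kernel z o = mass^-1.
Proof.
rewrite /sector_kernel big1 ?mulr0 ?addr0// => l _.
by rewrite basis_fun0 ?mulr0// (lvl_root T).
Qed.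

Definition sector_kernel_bound : R := mass^-1 + 4 * gram^-1.

Lemma sector_kernel_bound_ge0 : 0 <= sector_kernel_bound.
Proof. by rewrite addr_ge0 ?mulr_ge0 ?invr_ge0 ?ltW ?mass_gt0 ?gram_gt0. Qed.

(** The term at level l is supported in the sector of the ancestor of z at
    level l, and kappa <= 2. The term l = 0 of the right-hand side is 1 and
    absorbs the constant part of the kernel. *)
Lemma sector_kernel_le z x : `|sector_kernel z x| <=
  sector_kernel_bound * \sum_(l < (lvl z).+1) rho ^- l *
    (in_sector (ancestor l z) x)%:R.
Proof.
have r0 l : 0 <= rho ^- l by rewrite invr_ge0 exprn_ge0// ltW.
set S := \sum_(_ < _) _.
have S1 : 1 <= S.
  rewrite /S big_ord_recl expr0 invr1 (ancestor0 T) (in_sector_root T) mul1r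
    lerDl.
  by apply: sumr_ge0 => l _; rewrite mulr_ge0.
rewrite /sector_kernel mulrDl; apply: (le_trans (ler_normD _ _)); apply: lerD.
  rewrite ger0_norm ?invr_ge0 ?(ltW mass_gt0)// ler_peMr//.
  by rewrite invr_ge0 ltW ?mass_gt0.
rewrite normrM ger0_norm ?invr_ge0 ?(ltW gram_gt0)// [4 * _]mulrC -mulrA.
rewrite ler_wpM2l ?invr_ge0 ?(ltW gram_gt0)//;
  apply: (le_trans (ler_norm_sum _ _ _)).
apply: (@le_trans _ _ (\sum_(l < lvl z) 4 *
    (rho ^- l * (in_sector (ancestor l z) x)%:R))).
  apply: ler_sum => l _; have lz := ltn_ord l.
  rewrite normrM; have :=
    basis_fun_le R T q_ge2 x (ancestor_root T (x := z) (l := l.+1) lz).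
  rewrite (par_ancestor par lz)// => bf.
  have -> : 4 * (rho ^- l * (in_sector (ancestor l z) x)%:R) =
      (rho ^- l * 2) * (2 * (in_sector (ancestor l z) x)%:R) :> R by ring.
  apply: ler_pM => //; rewrite ger0_norm ?mulr_ge0 ?kappa_ge0//.
  by rewrite ler_wpM2l// kappa_le2.
by rewrite -big_distrr/= ler_wpM2l// /S big_ord_recr/= lerDl mulr_ge0.
Qed.

(** Both sides sum rho^-l over the levels at which z and x have the same
    ancestor. *)
Lemma common_ancestors z x :
  \sum_(l < (lvl z).+1) rho ^- l * (in_sector (ancestor l z) x)%:R =
  \sum_(l < (lvl x).+1) rho ^- l * (in_sector (ancestor l x) z)%:R.
Proof.
have E a b : (lvl a <= lvl z + lvl x)%N ->
    \sum_(l < (lvl a).+1) rho ^- l * (in_sector (ancestor l a) b)%:R =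
    \sum_(l < (lvl z + lvl x).+1 | (l <= lvl a)%N && ((l <= lvl b)%N &&
      (ancestor l a == ancestor l b))) rho ^- l.
  move=> la; rewrite (big_ord_widen_cond (lvl z + lvl x).+1 xpredT
    (fun l => rho ^- l * (in_sector (ancestor l a) b)%:R))//.
  rewrite big_mkcond [RHS]big_mkcond; apply: eq_bigr => l _ /=; rewrite ltnS.
  case: leqP => //= lz; rewrite (in_sectorE T)//.
  by case: ifP => _; rewrite ?mulr1 ?mulr0.
rewrite !E ?leq_addr ?leq_addl//; apply: eq_bigl => l;
  rewrite [ancestor l x == _]eq_sym.
by rewrite !andbA [(l <= lvl x)%N && _]andbC.
Qed.

(** When z is an ancestor of x, all terms of the kernel are nonnegative,
    because the geodesic from o to z stays inside the one to x; the last one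
    alone has the size rho^-m, and for m = 0 the constant term is enough. *)
Lemma sector_kernel_ge m x : (m <= lvl x)%N ->
  Num.min mass^-1 (rho / (2 * gram)) * rho ^- m <=
    sector_kernel (ancestor m x) x.
Proof.
move=> mx; rewrite /sector_kernel (lvl_ancestor T)//.
have r0 l : 0 <= rho ^- l by rewrite invr_ge0 exprn_ge0// ltW.
have i0 := mass_gt0; have g0 := gram_gt0.
have bf l : (l < m)%N -> 2^-1 <= basis_fun (ancestor l.+1 (ancestor m x)) x.
  move=> lm; rewrite (ancestor_ancestor T) ?lm//.
  have lx : (l < lvl x)%N by exact: leq_trans mx.
  rewrite /basis_fun (par_ancestor par lx)// !(in_sector_ancestor T)
    ?(ltnW lx)//.
  rewrite (lvl_ancestor T) ?(ltnW lx)// -[2^-1]mul1r.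
  have := child_count_ge2 R T q_ge2 (ancestor l x);
    move: (child_count _ _ _) => N N2.
  have N1 : N^-1 <= 2^-1 by rewrite lef_pV2 ?posrE//; lra.
  rewrite ler_pM ?invr_ge0//; last by rewrite /= div1r; lra.
  by rewrite -[(lvl x - l)%N]prednK ?subn_gt0//; exact: kappa_ge1.
have t0 (l : 'I_m) : 0 <= rho ^- l * kappa (m - l) *
    basis_fun (ancestor l.+1 (ancestor m x)) x.
  apply: mulr_ge0; first by rewrite mulr_ge0 ?kappa_ge0.
  apply: le_trans (bf l (ltn_ord l)).
  by rewrite invr_ge0.
case: m mx bf t0 => [|m] mx bf t0.
  by rewrite big_ord0 mulr0 addr0 expr0 invr1 mulr1 ge_min lexx.
rewrite big_ord_recr/=; set S := \sum_(_ < _) _.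
have S0 : 0 <= S by apply: sumr_ge0 => l _;
  exact: (t0 (widen_ord (leqnSn m) l)).
apply: (@le_trans _ _ (rho / (2 * gram) * rho ^- m.+1)).
  by rewrite ler_wpM2r// ge_min lexx orbT.
have := bf m (ltnSn m); rewrite subSnn kappa1//; move: (basis_fun _ _) => b b2.
have -> : rho / (2 * gram) * rho ^- m.+1 = gram^-1 * (rho ^- m * 2^-1).
  by rewrite exprS; field; rewrite expf_neq0 ?gt_eqF.
rewrite -[leLHS]add0r lerD ?invr_ge0 ?(ltW i0)// ler_wpM2l ?invr_ge0
  ?(ltW g0)//.
by rewrite -[leLHS]add0r lerD// mulr1 ler_wpM2l.
Qed.

(** Exchanging z and x in the sum over common ancestors leaves, for each
    ancestor of x, the weight of its sector, which is of the order of a power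
    of s. *)
Lemma column_le (s : R) x N : 0 < s -> Q * s < 1 ->
  \sum_(z <- tree_ball N) `|sector_kernel z x| * s ^+ lvl z <=
  sector_kernel_bound * (2 * (1 - Q * s)^-1) * \sum_(l < (lvl x).+1)
    (s / rho) ^+ l.
Proof.
move=> s0 s1.
have r0 l : 0 <= rho ^- l by rewrite invr_ge0 exprn_ge0// ltW.
apply: (@le_trans _ _ (\sum_(z <- tree_ball N) sector_kernel_bound *
   \sum_(l < (lvl x).+1) rho ^- l *
     ((in_sector (ancestor l x) z)%:R * s ^+ lvl z))).
  apply: ler_sum => z _.
  have -> : \sum_(l < (lvl x).+1) rho ^- l *
    ((in_sector (ancestor l x) z)%:R * s ^+ lvl z)
     = (\sum_(l < (lvl x).+1) rho ^- l * (in_sector (ancestor l x) z)%:R) *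
       s ^+ lvl z.
    by rewrite big_distrl; apply: eq_bigr => l _ /=; rewrite mulrA.
  by rewrite -common_ancestors mulrA ler_wpM2r ?sector_kernel_le// exprn_ge0//
    ltW.
rewrite -big_distrr/=
  -mulrA ler_wpM2l ?sector_kernel_bound_ge0// exchange_big big_distrr/=.
apply: ler_sum => l _; rewrite -big_distrr/= expr_div_n mulrA mulrC ler_wpM2r//.
have := sum_sector_weight_le T q_ge2 (ancestor l x) N s0 s1.
by rewrite (lvl_ancestor T)// -ltnS.
Qed.

(** It is enough to keep one vertex on each sphere, the ancestor of x. *)
Lemma column_ge (s : R) x : 0 < s ->
  Num.min mass^-1 (rho / (2 * gram)) * \sum_(l < (lvl x).+1) (s / rho) ^+ l <=
  \sum_(z <- tree_ball (lvl x).+1) `|sector_kernel z x| * s ^+ lvl z.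
Proof.
move=> s0; rewrite sum_tree_ball big_distrr; apply: ler_sum => l _.
have lx : (l <= lvl x)%N by rewrite -ltnS.
rewrite (bigD1_seq (ancestor l x))/=
  ?(uniq_sphere T) ?(mem_sphere T) ?(lvl_ancestor T)//.
rewrite -[leLHS]addr0 lerD//; last first.
  by apply: sumr_ge0 => z _; rewrite mulr_ge0// exprn_ge0// ltW.
rewrite expr_div_n mulrCA mulrC ler_wpM2r ?exprn_ge0 ?(ltW s0)//.
exact: le_trans (sector_kernel_ge lx) (ler_norm _).
Qed.

End Kernel.

(** * The Bergman kernel of a homogeneous tree *)

Section BergmanKernel.
Variables (R : realType) (X : choiceType) (adj : rel X) (o : X) (q : nat).
Hypothesis q_ge2 : (2 <= q)%N.
Hypothesis tree : homogeneous_tree adj q.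

Local Notation Q := (q%:R : R).
Local Notation lvl := (graph_dist adj o).
Local Notation par := (parent adj o).
Local Notation ch := (children adj o).
Local Notation w := (@qweight R X adj o q).
Local Notation rooted_harmonic := (rooted_harmonic o q par ch).

Let T : rooted_tree o q par ch lvl := tree_rooted o tree.
Let Q_gt1 : 1 < Q. Proof. by rewrite ltr1n. Qed.
Let Q_gt0 : 0 < Q. Proof. exact: lt_trans Q_gt1. Qed.

Lemma qweightE s x : w s x = (Q `^ (- s)) ^+ lvl x.
Proof. by rewrite /qweight -mulNr powRrM powR_mulrn ?powR_ge0. Qed.

Lemma ratio_gt0 s : 0 < Q `^ s.
Proof. exact: powR_gt0. Qed.

Lemma ratioM s t : Q `^ s * Q `^ t = Q `^ (s + t).
Proof. by rewrite powRD// (gt_eqF Q_gt0) /= implybT. Qed.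

Lemma ratio_lt s : (Q * Q `^ (- s) < 1) = (1 < s).
Proof.
rewrite -[X in X * _](powRr1 (ltW Q_gt0)) ratioM powR_lt1//.
by rewrite subr_lt0.
Qed.

(** Complex harmonic functions are handled through their real and imaginary
    parts; the sum over neighbours is split into parent and children. *)
Lemma tree_harmonicP (f : X -> R[i]) : tree_harmonic adj q f <->
  rooted_harmonic (fun x => complex.Re (f x)) /\
    rooted_harmonic (fun x => complex.Im (f x)).
Proof.
have ReD (u v : R[i]) : complex.Re (u + v) = complex.Re u + complex.Re v.
  by case: u v => [? ?] [].
have ImD (u v : R[i]) : complex.Im (u + v) = complex.Im u + complex.Im v.
  by case: u v => [? ?] [].
have ReS (s : seq X) : complex.Re (\sum_(u <- s) f u) =
  \sum_(u <- s) complex.Re (f u).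
  exact: (big_morph _ ReD).
have ImS (s : seq X) : complex.Im (\sum_(u <- s) f u) =
  \sum_(u <- s) complex.Im (f u).
  exact: (big_morph _ ImD).
have natE n (u : R[i]) : n%:R * u =
  Complex (n%:R * complex.Re u) (n%:R * complex.Im u).
  rewrite !mulr_natl; elim: n => [|n IH]; first by rewrite !mulr0n.
  by rewrite !mulrSr IH; case: u {IH}.
have E v : (f v = (q.+1)%:R^-1 * \sum_(u \in [set u | adj v u]) f u) <->
    (\sum_(u <- ch v) f u + (if v == o then 0 else f (par v)) = q.+1%:R * f v).
  rewrite (sum_neighbors o tree); split=> [->|->].
    by rewrite mulVKf// pnatr_eq0.
  by rewrite mulKf// pnatr_eq0.
split=> [fh|[reh imh] v].
  split=> v; have /E := fh v.
    move=> /(congr1 (@complex.Re R)); rewrite ReD ReS natE /= => <-.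
    by congr (_ + _); case: ifP.
  move=> /(congr1 (@complex.Im R)); rewrite ImD ImS natE /= => <-.
  by congr (_ + _); case: ifP.
apply/E; rewrite natE -reh -imh -ReS -ImS; move: (\sum_(u <- _) _) => s.
by case: ifP => _; [case: s => ? ?|case: s (f (par v)) => [? ?] []];
  rewrite /= ?addr0.
Qed.

Variable c : R.
Hypothesis c_gt1 : 1 < c.

Let rho := Q `^ (- c).
Let rho_gt0 : 0 < rho. Proof. exact: powR_gt0. Qed.
Let rho_lt : Q * rho < 1. Proof. by rewrite ratio_lt. Qed.

Definition tree_kernel : X -> X -> R := sector_kernel o q par ch lvl rho.

Lemma tree_kernel_bounded z : exists2 M, 0 <= M & forall x,
  `|tree_kernel z x| <= M.
Proof.
have r0 l : 0 <= rho ^- l by rewrite invr_ge0 exprn_ge0// ltW.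
exists (sector_kernel_bound o q ch lvl rho * \sum_(l < (lvl z).+1) rho ^- l).
  by rewrite mulr_ge0 ?sumr_ge0//; apply: (sector_kernel_bound_ge0 T).
move=> x; apply: le_trans (sector_kernel_le T q_ge2 rho_gt0 rho_lt z x) _.
rewrite ler_wpM2l//; first exact: (sector_kernel_bound_ge0 T).
by apply: ler_sum => l _; rewrite ler_piMr//; case: in_sector.
Qed.

Lemma weight_summable : (\esum_(x in setT) (w c x)%:E < +oo)%E.
Proof.
apply: le_lt_trans (ltry (2 * (1 - Q * rho)^-1)).
apply: (esum_exhaustion_le (uniq_tree_ball T) (homo_tree_ball T)
  (cover_tree_ball T)).
  by move=> x; rewrite qweight_ge0// ltnW.
move=> N; apply: le_trans (mass_partial_le T q_ge2 rho_gt0 rho_lt N).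
by rewrite le_eqVlt; apply/orP; left; apply/eqP; apply: eq_bigr => x _;
  rewrite qweightE.
Qed.

Lemma Lp_normpow2 (f : X -> R[i]) : Lp_normpow adj o q 2 c f =
  (\esum_(x in setT) (normc (f x) ^+ 2 * w c x)%:E)%E.
Proof. by apply: eq_esum => x _; rewrite powR_mulrn ?normc_ge0. Qed.

Lemma tree_kernel_Bergman z :
  in_Bergman2 adj o q c (fun x => (tree_kernel z x)%:C%C).
Proof.
have w0 x : 0 <= w c x by rewrite qweight_ge0// ltnW.
split.
  apply/tree_harmonicP; split => /=; last exact: (harmonic_cst T).
  exact: (harmonic_sector_kernel rho T q_ge2 z).
rewrite /in_Lp Lp_normpow2; have [M M0 KM] := tree_kernel_bounded z.
apply: (@le_lt_trans _ _ (\esum_(x in setT) ((M ^+ 2)%:E * (w c x)%:E))%E).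
  apply: le_esum => x _; rewrite -EFinM lee_fin normc_real ler_wpM2r//.
  by rewrite lerXn2r ?nnegrE.
rewrite esumZl ?sqr_ge0//.
by rewrite lte_mul_pinfty// ?weight_summable// lee_fin sqr_ge0.
Qed.

(** A row of the kernel is bounded, so |g K| <= M (1 + g^2) is summable against
    the finite weight; the sum is then the limit of the finite sums over balls.
    *)
Lemma tree_kernel_reproducing_real (g : X -> R) z : rooted_harmonic g ->
  (\esum_(x in setT) (g x ^+ 2 * w c x)%:E < +oo)%E ->
  real_sum (fun x => g x * tree_kernel z x * w c x) = g z.
Proof.
have w0 x : 0 <= w c x by rewrite qweight_ge0// ltnW.
move=> gh goo; have [M M0 KM] := tree_kernel_bounded z.
have soo : (\esum_(x in setT) `|g x * tree_kernel z x * w c x|%:E < +oo)%E.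
  apply: (@le_lt_trans _ _ (\esum_(x in setT)
      (M%:E * ((w c x)%:E + (g x ^+ 2 * w c x)%:E)))%E).
    apply: le_esum => x _; rewrite -EFinD -EFinM lee_fin !normrM.
    rewrite (ger0_norm (w0 x)) -[X in X + _]mul1r -mulrDl mulrA ler_wpM2r//.
    rewrite mulrC ler_pM//.
    have : `|g x| ^+ 2 = g x ^+ 2 by rewrite real_normK ?num_real.
    by have := normr_ge0 (g x); move: `|g x| => t t0 <-; nra.
  rewrite esumZl//; last by move=> x;
    rewrite -EFinD lee_fin addr_ge0// mulr_ge0// sqr_ge0.
  rewrite esumD; last 2 first.
  - by move=> x _; rewrite lee_fin.
  - by move=> x _; rewrite lee_fin mulr_ge0// sqr_ge0.
  by rewrite lte_mul_pinfty// lte_add_pinfty// weight_summable.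
have c1 := cvg_sum_exhaustion (uniq_tree_ball T) (homo_tree_ball T)
  (cover_tree_ball T) soo.
have := cvg_sector_kernel T q_ge2 rho_gt0 rho_lt (z := z) gh.
rewrite (_ : (fun _ => _) =
  (fun N => \sum_(x <- tree_ball ch o N) g x * tree_kernel z x * w c x)).
  by move/(cvg_unique _ c1); apply.
by apply/funext => N; apply: eq_bigr => x _; rewrite qweightE.
Qed.

Lemma tree_kernel_reproducing : is_reproducing_kernel adj o q c tree_kernel.
Proof.
have w0 x : 0 <= w c x by rewrite qweight_ge0// ltnW.
move=> z; split; first exact: tree_kernel_Bergman.
move=> g [/tree_harmonicP [reh imh]]; rewrite /in_Lp Lp_normpow2 => goo.
rewrite /complex_sum.
have -> : (fun x => complex.Re (g x * (tree_kernel z x)%:C%C * (w c x)%:C%C)) =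
    (fun x => complex.Re (g x) * tree_kernel z x * w c x).
  by apply/funext => x; rewrite !Re_mulrC.
have -> : (fun x => complex.Im (g x * (tree_kernel z x)%:C%C * (w c x)%:C%C)) =
    (fun x => complex.Im (g x) * tree_kernel z x * w c x).
  by apply/funext => x; rewrite !Im_mulrC.
rewrite (tree_kernel_reproducing_real z reh)
  ?(tree_kernel_reproducing_real z imh).
- by case: (g z).
- apply: le_lt_trans goo; apply: le_esum => x _; rewrite lee_fin ler_wpM2r//.
  by rewrite sqr_normc_ReIm lerDr sqr_ge0.
- apply: le_lt_trans goo; apply: le_esum => x _; rewrite lee_fin ler_wpM2r//.
  by rewrite sqr_normc_ReIm lerDl sqr_ge0.
Qed.

(** Apply the reproducing property of each kernel to a row of the other one. *)
Lemma reproducing_kernel_sym (K1 K2 : X -> X -> R) z x :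
  is_reproducing_kernel adj o q c K1 -> is_reproducing_kernel adj o q c K2 ->
  K1 z x = K2 x z.
Proof.
move=> h1 h2; have [b1 r1] := h1 z; have [b2 r2] := h2 x.
have := r1 _ b2; have := r2 _ b1.
rewrite (_ : (fun y => _ * _ * _) = fun y =>
  (K2 x y)%:C%C * (K1 z y)%:C%C * (w c y)%:C%C).
  by move=> -> [].
by apply/funext => y; rewrite [_%:C%C * _]mulrC.
Qed.

(** Comparing a reproducing kernel with the explicit one, and the explicit one
    with itself, symmetry gives uniqueness. *)
Lemma bergman_kernelE : bergman_kernel adj o q c = tree_kernel.
Proof.
apply: xget_unique; first exact: tree_kernel_reproducing.
move=> K hK; apply/funext => z; apply/funext => x.
rewrite (reproducing_kernel_sym z x hK tree_kernel_reproducing).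
exact: reproducing_kernel_sym tree_kernel_reproducing tree_kernel_reproducing.
Qed.

Variables a b alpha : R.
Let s := Q `^ (- (alpha + a)).
Let s_gt0 : 0 < s. Proof. exact: powR_gt0. Qed.
Let r := Q `^ (alpha - b).
Let p := Q `^ (c - (a + b)).

Local Notation bounded :=
  (exists C, column_bound adj o q tree_kernel a b alpha C).

Lemma sphere_ge n : Q ^+ n <= \sum_(x <- sphere ch o n) 1.
Proof.
have -> : \sum_(x <- sphere ch o n) 1 =
    \sum_(x <- sphere ch o (lvl o + n) | in_sector par lvl o x) 1 :> R.
  by rewrite (lvl_root T); apply: eq_bigl => x; rewrite (in_sector_root T).
case: n => [|n]; first by rewrite addn0 (sum_sector0 T).
rewrite (sum_sector T q_ge2); last exact: (harmonic_cst T).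
rewrite (increment_root T) mul0r addr0 mulr1 exprSr ler_wpM2l ?exprn_ge0
  ?(ltW Q_gt0)//.
by rewrite (child_count_root R T) ler_nat.
Qed.

(** The conditions on r and p come from letting the level of the column tend to
    infinity, so every level has to be occupied. *)
Lemma sphere_nonempty n : exists x, lvl x = n.
Proof.
have := sphere_ge n; case E: (sphere ch o n) => [|x t].
  by rewrite big_nil leNgt exprn_gt0.
by move=> _; exists x; apply/eqP; rewrite -(mem_sphere T) E mem_head.
Qed.

Lemma ratio_sr : s / rho * r = p.
Proof.
rewrite /s /rho /r /p -powRN !ratioM; congr (_ `^ _); ring.
Qed.

(** The factor r^n is the weight by which the column of a vertex of level n has
    to be multiplied in the Schur test. *)
Lemma column_sum n : (\sum_(l < n.+1) (s / rho) ^+ l) * r ^+ n =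
  \sum_(l < n.+1) r ^+ (n - l) * p ^+ l.
Proof.
rewrite big_distrl; apply: eq_bigr => l _ /=.
have ln : (l <= n)%N by rewrite -ltnS.
have -> : r ^+ n = r ^+ (n - l) * r ^+ l by rewrite -exprD subnK.
by rewrite -ratio_sr !exprMn mulrCA.
Qed.

Lemma qweight_r x : w (alpha - b) x = (r ^+ lvl x)^-1.
Proof. by rewrite qweightE /r powRN exprVn. Qed.

(** Necessity of 1 < alpha + a comes from the column of o, where the kernel is
    constant and the spheres have at least q^n points; for the rest, the upper
    and lower estimates of the columns coincide up to constants. *)
Lemma column_boundP : bounded <->
  1 < alpha + a /\ [/\ r <= 1, p <= 1 & (r < 1) || (p < 1)].
Proof.
have r0 : 0 < r := ratio_gt0 _.
have p0 : 0 < p := ratio_gt0 _.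
have rn n : 0 < r ^+ n by rewrite exprn_gt0.
have term0 z x : 0 <= `|tree_kernel z x| * w (alpha + a) z.
  by rewrite mulr_ge0// qweight_ge0// ltnW.
have mass0 := mass_gt0 T q_ge2 rho_gt0 rho_lt.
have gram0 := gram_gt0 q_ge2 rho_gt0 rho_lt.
split=> [[C bd]|[sa rp]].
  have ballle x N : \sum_(z <- tree_ball ch o N) `|tree_kernel z x| * s ^+
    lvl z <= C * (r ^+ lvl x)^-1.
    rewrite -qweight_r -lee_fin; apply: le_trans (bd x).
    apply: le_trans (sum_exhaustion_le (B := tree_ball ch o)
      (uniq_tree_ball T) _ N).
    by rewrite lee_fin ler_sum// => z _; rewrite qweightE.
  split.
    rewrite -ratio_lt ltNge; apply/negP => sge.
    apply: (@natr_bounded_false R (mass o ch lvl rho * C)) => N.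
    rewrite -ler_pdivrMl//; apply: le_trans (le_trans (ballle o N) _).
      rewrite sum_tree_ball -[N in N%:R]card_ord -sumr_const big_distrr.
      apply: ler_sum => k _ /=.
      rewrite (eq_big_seq (fun=> (mass o ch lvl rho)^-1 * (s ^+ k * 1)));
        last first.
        move=> z; rewrite (mem_sphere T) => /eqP ->.
        by rewrite /tree_kernel (sector_kernel_root rho T) mulr1 ger0_norm//
          invr_ge0 ltW.
      rewrite -!big_distrr/= ler_wpM2l ?invr_ge0 ?(ltW mass0)//.
      apply: le_trans (ler_wpM2l _ (sphere_ge k));
        last by rewrite exprn_ge0// ltW.
      by rewrite -exprMn mulrC exprn_ege1.
    by rewrite graph_distxx expr0 invr1 mulr1.
  apply/mixed_geometric_bounded => //.
  set k := Num.min (mass o ch lvl rho)^-1 (rho / (2 * gram q rho)).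
  have k0 : 0 < k by rewrite lt_min invr_gt0 mass0 divr_gt0// mulr_gt0.
  exists (k^-1 * C) => n; have [x xn] := sphere_nonempty n.
  rewrite -column_sum -ler_pdivlMr// -mulrA ler_pdivlMl// -xn.
  exact: le_trans (column_ge T q_ge2 rho_gt0 rho_lt x s_gt0) (ballle x _).
have [D hD] := (mixed_geometric_bounded r0 p0).2 rp.
have sQ : Q * s < 1 by rewrite ratio_lt.
set k := sector_kernel_bound o q ch lvl rho * (2 * (1 - Q * s)^-1).
exists (k * D) => x.
apply: (esum_exhaustion_le (uniq_tree_ball T) (homo_tree_ball T)
  (cover_tree_ball T)) => // N.
have k0 : 0 <= k.
  rewrite mulr_ge0 ?mulr_ge0 ?invr_ge0 ?subr_ge0 ?(ltW sQ)//.
  exact: (sector_kernel_bound_ge0 T).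
apply: (@le_trans _ _ (k * \sum_(l < (lvl x).+1) (s / rho) ^+ l)).
  apply: le_trans (column_le T q_ge2 rho_gt0 rho_lt x N s_gt0 sQ).
  by rewrite ler_sum// => z _; rewrite qweightE.
rewrite qweight_r -mulrA ler_wpM2l// ler_pdivlMr// column_sum.
exact: hD.
Qed.

Lemma parameter_range :
  (1 < alpha + a /\ [/\ r <= 1, p <= 1 & (r < 1) || (p < 1)]) <->
  [/\ c = a + b, - a < alpha - 1 & alpha - 1 < b - 1] \/
  [/\ c < a + b, - a < alpha - 1 & alpha - 1 <= b - 1].
Proof.
rewrite /r /p !powR_le1// !powR_lt1//; split.
  move=> [sa [ab cab strict]].
  have [cl|cg|cE] := ltrgtP c (a + b); [right|lra|left].
  - split; lra.
  - by split; [|lra|]; case/orP: strict => ?; lra.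
move=> [[-> h1 h2]|[h0 h1 h2]]; split; try lra.
  by split; try lra; apply/orP; left; lra.
by split; try lra; apply/orP; right; lra.
Qed.

End BergmanKernel.

Theorem theorem15 (R : realType) (X : choiceType) (adj : rel X) (o : X)
    (q : nat) (hq : (2 <= q)%N) (hX : homogeneous_tree adj q)
    (a b alpha c : R) (halpha : 1 < alpha) (hc : 1 < c) :
  (S_bounded adj o q a b c 1 alpha <-> T_bounded adj o q a b c 1 alpha) /\
  (T_bounded adj o q a b c 1 alpha <->
     [/\ c = a + b, - a < alpha - 1 & alpha - 1 < b - 1] \/
     [/\ c < a + b, - a < alpha - 1 & alpha - 1 <= b - 1]).
Proof.
have q0 : (0 < q)%N by exact: ltnW.
rewrite /S_bounded /T_bounded (bergman_kernelE o hq hX hc).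
set K := tree_kernel adj o q c.
have bounded_column N : integral_op_bounded adj o q N a b 1 alpha <->
    exists C, column_bound adj o q N a b alpha C.
  split; first exact: integral_op_bounded_column.
  by move=> [C]; exact: column_bound_integral_op.
have abs_column C : column_bound adj o q (fun z x => `|K z x|) a b alpha C <->
    column_bound adj o q K a b alpha C.
  by split=> H x; apply: le_trans (H x); apply: le_esum => z _; rewrite normr_id.
split.
  apply: (iff_trans (bounded_column _)).
  apply: (iff_trans _ (iff_sym (bounded_column _))).
  by split=> -[C /abs_column H]; exists C.
apply: (iff_trans (bounded_column _)).
apply: (iff_trans (column_boundP o hq hX hc a b alpha)).
exact: parameter_range.
Qed.
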